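(* Let $f:\mathbb{R}^d\to\mathbb{R}$ be differentiable, with $L$-Lipschitz gradient for some $L>0$ and $\mu$-strongly convex for some $\mu>0$, with unique minimizer $\mathbf{x}^\star$. Let $\boldsymbol{\Psi}:\mathbb{R}^d\to\mathbb{R}^d$ be an admissible (component-wise or joint) nonlinearity with $\|\boldsymbol{\Psi}(\mathbf{x})\|\le C$, and let the noise sequence $\{\mathbf{z}^{(t)}\}_{t\in\mathbb{N}_0}$ satisfy the noise assumption (both as defined in the context). Let $\mathbf{x}^{(0)}\in\mathbb{R}^d$ be deterministic and let $$\mathbf{x}^{(t+1)}=\mathbf{x}^{(t)}-\alpha_t\boldsymbol{\Psi}\big(\nabla f(\mathbf{x}^{(t)})+\mathbf{z}^{(t)}\big),\qquad \alpha_t=\frac{a}{(t+2)^\delta},$$ for any $\delta\in(0.5,1)$ and $a>0$. Then there is a (deterministic) constant $\gamma=\gamma(a)>0$, independent of $t$ and $\beta$, satisfying almost surely $$\langle\boldsymbol{\Phi}(\nabla f(\mathbf{x}^{(t)})),\nabla f(\mathbf{x}^{(t)})\rangle\ge\gamma(t+2)^{\delta-1}\|\nabla f(\mathbf{x}^{(t)})\|^2\quad\text{for all }t\in\mathbb{N}_0,$$ such that for any $t\in\mathbb{N}_0$ and any $\beta\in(0,1)$, with probability at least $1-\beta$, $$\|\mathbf{x}^{(t+1)}-\mathbf{x}^\star\|^2\le\frac{2\log(e/\beta)}{\mu B(t+2)^{\zeta}},$$ where $$\zeta=\min\left\{2\delta-1,\frac{a\mu\gamma}{2}\right\},\qquad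 B=\min\left\{\frac{1}{f(\mathbf{x}^{(0)})-f^\star},\frac{\mu\gamma}{aL(2N+C^2/2)}\right\}.$$
   Context: Norms and inner products are Euclidean. $\mu$-strong convexity: $f(\mathbf{y})\ge f(\mathbf{x})+\langle\nabla f(\mathbf{x}),\mathbf{y}-\mathbf{x}\rangle+\frac{\mu}{2}\|\mathbf{x}-\mathbf{y}\|^2$ for all $\mathbf{x},\mathbf{y}$. $f^\star=\inf_{\mathbf{x}}f(\mathbf{x})=f(\mathbf{x}^\star)$; in the definition of $B$, $1/0$ is read as $+\infty$. Admissible nonlinearity: $\boldsymbol{\Psi}$ has one of the following two forms. (Component-wise) $\boldsymbol{\Psi}(\mathbf{x})=[\mathcal{N}_1(x_1),\ldots,\mathcal{N}_1(x_d)]^\top$, where $\mathcal{N}_1:\mathbb{R}\to\mathbb{R}$ is continuous almost everywhere (Lebesgue) and piecewise differentiable; monotonically non-decreasing and odd; either discontinuous at zero or strictly increasing on $(-c_1,c_1)$ for some $c_1>0$; and $|\mathcal{N}_1(x)|\le C_1$ for all $x$, for some $C_1>0$. In this case $C=C_1\sqrt d$. (Joint) $\boldsymbol{\Psi}(\mathbf{x})=\mathbf{x}\,\mathcal{N}_2(\|\mathbf{x}\|)$, where $\mathcal{N}_2$ is continuous almost everywhere, non-increasing, $\mathcal{N}_2(r)>0$ for all $r>0$, the map $r\mapsto r\mathcal{N}_2(r)$ is non-decreasing, and $\|\mathbf{x}\,\mathcal{N}_2(\|\mathbf{x}\|)\|\le C_2$ for all $\mathbf{x}\in\mathbb{R}^d$,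 for some $C_2>0$. In this case $C=C_2$. Noise assumption: the vectors $\{\mathbf{z}^{(t)}\}_{t\in\mathbb{N}_0}$ in $\mathbb{R}^d$ are independent, identically distributed, integrable and zero mean, with a symmetric probability density $p:\mathbb{R}^d\to[0,\infty)$ ($p(-\mathbf{z})=p(\mathbf{z})$) such that $p(\mathbf{z})>0$ for all $\|\mathbf{z}\|\le B_0$, for some $B_0>0$. $\boldsymbol{\Phi}(\mathbf{x})=\mathbb{E}_{\mathbf{z}}[\boldsymbol{\Psi}(\mathbf{x}+\mathbf{z})]=\int\boldsymbol{\Psi}(\mathbf{x}+\mathbf{z})p(\mathbf{z})\,d\mathbf{z}$. For a component-wise nonlinearity its $i$-th component is $\phi_i(x_i)=\mathbb{E}[\mathcal{N}_1(x_i+z_i)]$, and it is taken as given from prior work (Polyak–Tsypkin) that each $\phi_i$ is non-decreasing and odd, and differentiable at zero with $\phi_i'(0)>0$. $N>0$ is a constant, depending only on the nonlinearity, such that the effective noise $\mathbf{e}^{(t)}=\boldsymbol{\Phi}(\nabla f(\mathbf{x}^{(t)}))-\boldsymbol{\Psi}(\nabla f(\mathbf{x}^{(t)})+\mathbf{z}^{(t)})$ satisfies $\mathbb{E}[\exp(\langle\mathbf{x},\mathbf{e}^{(t)}\rangle)\mid\mathcal{F}_t]\le\exp(N\|\mathbf{x}\|^2)$ for all $\mathcal{F}_t$-measurable (in particular all deterministic) $\mathbf{x}\in\mathbb{R}^d$ and all $t$, where $\mathcal{F}_t=\sigma(\mathbf{z}^{(0)},\ldots,\mathbf{z}^{(t-1)})$,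 $\mathcal{F}_0$ trivial (such a constant exists).
   Formalization: In dimension d = 1 the fact taken as given (φ non-decreasing, odd, differentiable at zero with φ'(0) > 0) is also assumed for joint nonlinearities, since these are component-wise in form; without it a joint case with d = 1 and a density degenerating near zero is a counterexample. *)

(* Defs.v *)
From HB Require Import structures.
From mathcomp Require Import all_boot all_order all_algebra.
From mathcomp Require Import all_classical all_reals all_analysis.
From mathcomp Require Import measurable_realfun.

Set Implicit Arguments.
Unset Strict Implicit.
Unset Printing Implicit Defensive.
Import Order.TTheory GRing.Theory Num.Theory.
Import numFieldNormedType.Exports.
Local Open Scope classical_set_scope.
Local Open Scope ring_scope.

(* R^d is ['rV[R]_d]. The norm [`|x|] that the library puts on it is the
   sup-norm, so the Euclidean structure is defined here; the two norms give the
   same topology, hence the same notion of differentiability. *)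
Section euclidean.
Context {R : realType} {d : nat}.
Implicit Types u v x : 'rV[R]_d.

Definition dotv u v : R := \sum_(i < d) u 0 i * v 0 i.

Definition normv u : R := Num.sqrt (dotv u u).

Definition grad (f : 'rV[R]_d -> R) x : 'rV[R]_d :=
  \row_i 'D_(delta_mx 0 i) f x.

Definition lipschitz_grad (L : R) (f : 'rV[R]_d -> R) :=
  forall x y, normv (grad f x - grad f y) <= L * normv (x - y).

Definition strongly_convex (mu : R) (f : 'rV[R]_d -> R) :=
  forall x y,
    f y >= f x + dotv (grad f x) (y - x) + mu / 2 * normv (x - y) ^+ 2.

End euclidean.

(* The sigma-algebra on R^d is generated by the coordinate maps (as the library
   does for tuples): it is the Borel sigma-algebra of R^d. *)
Definition rV_display : measure_display -> measure_display.
Proof. exact. Qed.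

Section measurable_rV.
Context {R : realType}.
Variable n : nat.

Let coord (i : 'I_n) (x : 'rV[R]_n) : R := x 0 i.

Let rV_set0 : g_sigma_preimage coord set0.
Proof. exact: sigma_algebra0. Qed.

Let rV_setC A : g_sigma_preimage coord A -> g_sigma_preimage coord (~` A).
Proof. exact: sigma_algebraC. Qed.

Let rV_bigcup (F : (set 'rV[R]_n)^nat) :
  (forall i, g_sigma_preimage coord (F i)) ->
  g_sigma_preimage coord (\bigcup_i (F i)).
Proof. exact: sigma_algebra_bigcup. Qed.

HB.instance Definition _ := @isMeasurable.Build (rV_display default_measure_display)
  ('rV[R]_n) (g_sigma_preimage coord) rV_set0 rV_setC rV_bigcup.

Lemma measurable_coord (i : 'I_n) :
  measurable_fun [set: 'rV[R]_n] (fun x : 'rV[R]_n => x 0 i).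
Proof.
move=> _ Y mY; rewrite setTI; apply: sub_sigma_algebra => /=.
rewrite -bigcup_seq/=; exists i => /=; first by rewrite mem_index_enum.
by exists Y => //; rewrite setTI.
Qed.

End measurable_rV.

Lemma measurable_fun_rVP {R : realType} {d} {T : measurableType d} {n : nat}
    (f : T -> 'rV[R]_n) :
  (forall i, measurable_fun [set: T] (fun t => f t 0 i)) ->
  measurable_fun [set: T] f.
Proof.
move=> mf; apply: (@measurability _ _ _ _ _ _
  (\big[setU/set0]_(i < n)
    preimage_set_system setT (fun x : 'rV[R]_n => x 0 i) measurable)) => //.
move=> _ [B + <-]; rewrite -bigcup_seq => -[i _ [A mA <-]].
by rewrite setTI; apply: mf.
Qed.

Section lebesgue_rV.
Context {R : realType}.
Local Open Scope ereal_scope.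

Definition rV_cons n (xv : R * 'rV[R]_n) : 'rV[R]_n.+1 :=
  row_mx (xv.1%:M : 'rV[R]_1) xv.2.

Lemma rV_cons0 n (xv : R * 'rV[R]_n) : rV_cons xv ord0 ord0 = xv.1.
Proof.
have -> : ord0 = lshift n (ord0 : 'I_1) by exact/val_inj.
by rewrite [LHS](row_mxEl _ xv.2) mxE eqxx.
Qed.

Lemma rV_consS n (xv : R * 'rV[R]_n) (i : 'I_n) :
  rV_cons xv ord0 (lift ord0 i) = xv.2 ord0 i.
Proof.
have -> : lift ord0 i = rshift 1 i by exact/val_inj.
exact: row_mxEr.
Qed.

Lemma measurable_rV_cons n : measurable_fun [set: R * 'rV[R]_n] (@rV_cons n).
Proof.
apply: measurable_fun_rVP => i; case: (unliftP ord0 i) => [j ->|->].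
  under eq_fun do rewrite rV_consS.
  by apply: (measurableT_comp (measurable_coord j)); exact: measurable_snd.
by under eq_fun do rewrite rV_cons0; exact: measurable_fst.
Qed.

Section step.
Variables (n : nat) (mu : {sigma_finite_measure set 'rV[R]_n -> \bar R}).

Definition lebesgue_step : set 'rV[R]_n.+1 -> \bar R :=
  pushforward (lebesgue_measure \x mu) (@rV_cons n).

Let step0 : lebesgue_step set0 = 0.
Proof. by rewrite /lebesgue_step /pushforward preimage_set0 measure0. Qed.

Let step_ge0 A : 0 <= lebesgue_step A.
Proof. by rewrite /lebesgue_step /pushforward measure_ge0. Qed.

Let step_sigma_additive : semi_sigma_additive lebesgue_step.
Proof.
apply: (@measure_semi_sigma_additive _ _ _
  (pushforward (lebesgue_measure \x mu) (@rV_cons n))).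
exact: measurable_rV_cons.
Qed.

HB.instance Definition _ := isMeasure.Build _ _ _ lebesgue_step
  step0 step_ge0 step_sigma_additive.

Let step_sigma_finite : sigma_finite setT lebesgue_step.
Proof.
have /sigma_finiteP[F [TF ndF Foo]] :=
  sigma_finiteT (@lebesgue_measure R : {sigma_finite_measure set _ -> \bar R}).
have /sigma_finiteP[G [TG ndG Goo]] := sigma_finiteT mu.
pose g (x : 'rV[R]_n.+1) : R * 'rV[R]_n :=
  (x ord0 ord0, \row_i x ord0 (lift ord0 i)).
have gK : g \o @rV_cons n = id.
  apply/funext => -[x v]; rewrite /g /= rV_cons0; congr (_, _).
  by apply/rowP => i; rewrite mxE rV_consS.
have mg : measurable_fun [set: 'rV[R]_n.+1] g.
  apply/measurable_fun_pair; first exact: measurable_coord.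
  apply: measurable_fun_rVP => i /=.
  by under eq_fun do rewrite mxE; exact: measurable_coord.
exists (fun k => g @^-1` (F k `*` G k)).
  apply/seteqP; split => // x _.
  have [k _ Fk] : (\bigcup_i F i) (g x).1 by rewrite -TF.
  have [l _ Gl] : (\bigcup_i G i) (g x).2 by rewrite -TG.
  exists (maxn k l) => //; split.
    by move: Fk; exact/subsetPset/ndF/leq_maxl.
  by move: Gl; exact/subsetPset/ndG/leq_maxr.
move=> k; have [mF Fk] := Foo k; have [mG Gk] := Goo k.
have mFG : measurable (F k `*` G k) by exact: measurableX.
split; first by rewrite -[X in measurable X]setTI; exact: mg.
rewrite /lebesgue_step /pushforward -comp_preimage gK.
by rewrite product_measure1E// lte_mul_pinfty// ge0_fin_numE.
Qed.

HB.instance Definition _ := Measure_isSigmaFinite.Build _ _ _ lebesgue_step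
  step_sigma_finite.

End step.

Fixpoint lebesgue_rV n : {sigma_finite_measure set 'rV[R]_n -> \bar R} :=
  if n is n'.+1 then lebesgue_step (lebesgue_rV n') else \d_(0%R : 'rV[R]_0).

Lemma lebesgue_rV_box n (A : 'I_n -> set R) : (forall i, measurable (A i)) ->
  lebesgue_rV n [set x | forall i, A i (x ord0 i)] =
  \prod_(i < n) lebesgue_measure (A i).
Proof.
elim: n A => [|n IH] A mA /=.
  by rewrite big_ord0 diracE mem_set//= => -[].
rewrite big_ord_recl -IH// /lebesgue_step /pushforward /=.
rewrite -(@product_measure1E _ _ _ _ _ lebesgue_measure)//=.
- congr (_ _); apply/seteqP; split=> -[x v] /=.
    move=> H; split; first by have := H ord0; rewrite rV_cons0.
    by move=> i; have := H (lift ord0 i); rewrite rV_consS.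
  move=> [H1 H2] i; case: (unliftP ord0 i) => [j ->|->].
    by rewrite rV_consS.
  by rewrite rV_cons0.
- exact: (mA ord0).
- rewrite [X in measurable X](_ : _ =
    \bigcap_i ((fun x : 'rV[R]_n => x ord0 i) @^-1` A (lift ord0 i))).
    apply: fin_bigcap_measurable => // i _.
    by rewrite -[X in measurable X]setTI; exact: measurable_coord.
  by apply/seteqP; split=> x /= H i; [move=> _|]; exact: H.
Qed.

End lebesgue_rV.

Section nonlinearity.
Context {R : realType} {d : nat}.
Implicit Types Psi : 'rV[R]_d -> 'rV[R]_d.

(* There may be infinitely many breakpoints, but only finitely many of them in
   each bounded interval. *)
Definition piecewise_differentiable (N1 : R -> R) :=
  exists S : set R, (forall r s, finite_set (S `&` `[r, s])) /\
    forall x, ~ S x -> derivable N1 x 1.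

Record admissible_N1 (N1 : R -> R) (C1 : R) : Prop := AdmissibleN1 {
  N1_ae_continuous :
    {ae lebesgue_measure, forall x : R, {for x, continuous N1}} ;
  N1_piecewise_differentiable : piecewise_differentiable N1 ;
  N1_nondecreasing : {homo N1 : x y / x <= y} ;
  N1_odd : forall x, N1 (- x) = - N1 x ;
  N1_near0 : ~ {for 0, continuous N1} \/
    exists2 c1, 0 < c1 & {in `]- c1, c1[ &, {homo N1 : x y / x < y}} ;
  N1_bound_gt0 : 0 < C1 ;
  N1_bounded : forall x, `|N1 x| <= C1
}.

(* N2 is a function of a radius: its values at negative reals are irrelevant.
   Its value at 0 does not affect the nonlinearity x * N2(|x|), so that N2 is
   only required to be non-increasing on ]0, +oo[; this includes the
   normalization N2(r) = 1/r. *)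
Record admissible_N2 (N2 : R -> R) (C2 : R) : Prop := AdmissibleN2 {
  N2_ae_continuous :
    {ae lebesgue_measure, forall r : R, 0 < r -> {for r, continuous N2}} ;
  N2_nonincreasing : {in `]0, +oo[ &, {homo N2 : r s / r <= s >-> s <= r}} ;
  N2_gt0 : forall r, 0 < r -> 0 < N2 r ;
  N2_nondecreasing :
    {in `[0, +oo[ &, {homo (fun r => r * N2 r) : r s / r <= s}} ;
  N2_bound_gt0 : 0 < C2 ;
  N2_bounded : forall x : 'rV[R]_d, normv (N2 (normv x) *: x) <= C2
}.

Definition componentwise Psi (N1 : R -> R) := forall x, Psi x = map_mx N1 x.

Definition joint Psi (N2 : R -> R) := forall x, Psi x = N2 (normv x) *: x.

Definition admissible Psi (C : R) :=
  (exists N1 C1, [/\ componentwise Psi N1, admissible_N1 N1 C1 &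
                     C = C1 * Num.sqrt d%:R]) \/
  (exists N2 C2, [/\ joint Psi N2, admissible_N2 N2 C2 & C = C2]).

End nonlinearity.

Section noise.
Context {R : realType} {d : nat} {disp : measure_display}.
Context {T : measurableType disp} (P : probability T R).
Implicit Types (z : nat -> {RV P >-> 'rV[R]_d}) (p : 'rV[R]_d -> R).

Definition independent z := forall (s : seq nat) (A : nat -> set 'rV[R]_d),
  uniq s -> (forall i, measurable (A i)) ->
  P (\bigcap_(i in [set` s]) z i @^-1` A i) =
  (\prod_(i <- s) P (z i @^-1` A i))%E.

(* Identical distribution is expressed by the common density p. *)
Record noise_assumption z p : Prop := NoiseAssumption {
  noise_independent : independent z ;
  noise_integrable : forall t (i : 'I_d),
    P.-integrable setT (fun w => (z t w 0 i)%:E) ;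
  noise_mean : forall t (i : 'I_d), ('E_P[fun w => z t w 0%R i] = 0)%E ;
  noise_density_measurable : measurable_fun setT p ;
  noise_density_ge0 : forall x, 0 <= p x ;
  noise_density : forall t (A : set 'rV[R]_d), measurable A ->
    distribution P (z t) A = (\int[lebesgue_rV d]_(x in A) (p x)%:E)%E ;
  noise_symmetric : forall x, p (- x) = p x ;
  noise_positive : exists2 B0, 0 < B0 & forall x, normv x <= B0 -> 0 < p x
}.

Definition filtration z (t : nat) : set (set T) :=
  <<s \bigcup_(s in `I_t) preimage_set_system setT (z s) measurable >>.

Definition measurable_wrt {disp'} {T' : sigmaRingType disp'}
    (G : set (set T)) (X : T -> T') :=
  forall B, measurable B -> G (X @^-1` B).

(* W is a version of E[Y | G], for a nonnegative Y. *)
Definition is_cond_exp (G : set (set T)) (Y W : T -> \bar R) :=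
  [/\ measurable_wrt G W, (forall w, 0 <= W w)%E &
      forall A, G A ->
        (\int[P]_(w in A) W w = \int[P]_(w in A) Y w)%E].

End noise.

Section expected_nonlinearity.
Context {R : realType} {d : nat}.
Implicit Types (Psi : 'rV[R]_d -> 'rV[R]_d) (p : 'rV[R]_d -> R).

Definition Phi Psi p (x : 'rV[R]_d) : 'rV[R]_d :=
  \row_i (\int[lebesgue_rV d]_z (Psi (x + z) 0 i * p z)).

Definition phi (N1 : R -> R) p (i : 'I_d) (x : R) : R :=
  \int[lebesgue_rV d]_z (N1 (x + z 0 i) * p z).

(* The properties known from Polyak and Tsypkin. They are stated for every
   component-wise map: when d = 1 this includes the joint nonlinearities. *)
Definition polyak_tsypkin Psi p := forall N1, componentwise Psi N1 ->
  forall i : 'I_d,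
    [/\ {homo phi N1 p i : x y / x <= y},
        forall x, phi N1 p i (- x) = - phi N1 p i x,
        derivable (phi N1 p i) 0 1 &
        0 < (phi N1 p i)^`()%classic 0].

End expected_nonlinearity.

Section sgd.
Context {R : realType} {d : nat} {disp : measure_display}.
Context {T : measurableType disp} {P : probability T R}.
Variables (z : nat -> {RV P >-> 'rV[R]_d}) (p : 'rV[R]_d -> R).
Variables (f : 'rV[R]_d -> R) (Psi : 'rV[R]_d -> 'rV[R]_d).
Variables (alpha : nat -> R) (x0 : 'rV[R]_d).

Fixpoint sgd (t : nat) (w : T) : 'rV[R]_d :=
  if t is s.+1 then
    sgd s w - alpha s *: Psi (grad f (sgd s w) + z s w)
  else x0.

Definition effective_noise (t : nat) (w : T) : 'rV[R]_d :=
  Phi Psi p (grad f (sgd t w)) - Psi (grad f (sgd t w) + z t w).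

Definition subgaussian_effective_noise (N : R) :=
  forall t (x : T -> 'rV[R]_d), measurable_wrt (filtration z t) x ->
    exists W,
      is_cond_exp P (filtration z t)
        (fun w => (expR (dotv (x w) (effective_noise t w)))%:E) W /\
      {ae P, forall w, (W w <= (expR (N * normv (x w) ^+ 2))%:E)%E}.

End sgd.

Section constants.
Context {R : realType}.

Definition step_size (a delta : R) (t : nat) : R := a / (t.+2%:R `^ delta).

Definition zeta_const (a mu delta gamma : R) : R :=
  Num.min (2 * delta - 1) (a * mu * gamma / 2).

(* [gap] is f(x0) - inf f. The inverse on [\bar R] satisfies 0^-1 = +oo, and the
   second argument of the minimum is finite. *)
Definition B_const (gap a L mu N C gamma : R) : R :=
  fine (mine (gap%:E^-1) (mu * gamma / (a * L * (2 * N + C ^+ 2 / 2)))%:E)%E.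

End constants.

(* Main.v *)
(* The gradient step gives F(t+1) <= F(t) - alpha_t <g_t, Phi g_t>
   + alpha_t <g_t, e_t> + alpha_t^2 L C^2 / 2 for the gap F = f - f*. On the one
   hand <Phi x, x> >= c min(|x|, |x|^2), while the bounded steps make |g_t| grow
   at most like (t + 2)^(1 - delta); this yields the rate gamma. On the other
   hand the noise e_t is conditionally sub-Gaussian, and its variance term is
   absorbed by the drift because |g|^2 <= 2 L F. Together with |g|^2 >= 2 mu F
   this gives, by induction on t, E exp(b (t + 1)^zeta F(t)) <= exp(b / B)
   simultaneously for all b in [0, B]; Markov's inequality at b = B and the
   quadratic growth of f conclude. *)

(* Since [Psi] is bounded, <Phi x, x> grows only linearly in |x|, and the weaker rate gamma (t +
   2)^(delta - 1), multiplied by the step size, leaves a drift of order u = 1/(t + 2). With lam = a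
   mu gamma, this drift contracts the gap by the fraction 2 lam u per step, and that budget dictates
   the constants. One lam u pays for passing from the weight (t + 1)^zeta to (t + 2)^zeta. The other
   pays for the variance of the noise and for a small decrease of the rate b, which in turn absorbs
   the additive error alpha_t^2 L C^2 / 2; the second argument of the minimum [B] says exactly that
   both fit. The first argument starts the induction. For a joint nonlinearity <Psi(x + z), x> can
   be negative for a given z, so positivity can only come from the symmetry of the noise. *)
Require Import Defs.
From HB Require Import structures.
From mathcomp Require Import all_boot all_order all_algebra.
From mathcomp Require Import all_classical all_reals all_analysis.
From mathcomp Require Import measurable_realfun.
From mathcomp Require Import ring lra.
From mathcomp Require Import zify.
Set Implicit Arguments.
Unset Strict Implicit.
Unset Printing Implicit Defensive.
Import Order.TTheory GRing.Theory Num.Theory.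
Import numFieldNormedType.Exports.
Local Open Scope classical_set_scope.
Local Open Scope ring_scope.

(** * Euclidean geometry *)

Section euclidean_space.
Context {R : realType} {d : nat}.
Implicit Types u v w : 'rV[R]_d.

Lemma dotvC u v : dotv u v = dotv v u.
Proof. by apply: eq_bigr => i _; rewrite mulrC. Qed.

Lemma dotvDl u v w : dotv (u + v) w = dotv u w + dotv v w.
Proof. by rewrite -big_split; apply: eq_bigr => i _; rewrite mxE mulrDl. Qed.

Lemma dotvZl k u v : dotv (k *: u) v = k * dotv u v.
Proof. by rewrite mulr_sumr; apply: eq_bigr => i _; rewrite mxE mulrA. Qed.

Lemma dotvDr u v w : dotv u (v + w) = dotv u v + dotv u w.
Proof. by rewrite dotvC dotvDl !(dotvC u). Qed.

Lemma dotvZr k u v : dotv u (k *: v) = k * dotv u v.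
Proof. by rewrite dotvC dotvZl dotvC. Qed.

Lemma dotvNl u v : dotv (- u) v = - dotv u v.
Proof. by rewrite -scaleN1r dotvZl mulN1r. Qed.

Lemma dotvNr u v : dotv u (- v) = - dotv u v.
Proof. by rewrite dotvC dotvNl dotvC. Qed.

Definition dotvE := (dotvDl, dotvDr, dotvNl, dotvNr, dotvZl, dotvZr).

Lemma dotv0r u : dotv u 0 = 0.
Proof. by rewrite -(scale0r u) dotvZr mul0r. Qed.

Lemma dotv0l u : dotv 0 u = 0.
Proof. by rewrite dotvC dotv0r. Qed.

Lemma dotvv_ge0 u : 0 <= dotv u u.
Proof. by apply: sumr_ge0 => i _; rewrite -expr2 sqr_ge0. Qed.

Lemma dotvv_eq0 u : dotv u u = 0 -> u = 0.
Proof.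
move=> /psumr_eq0P u0; apply/rowP => i; rewrite mxE.
have /eqP := u0 (fun j _ => ltac:(rewrite -expr2 sqr_ge0//)) i isT.
by rewrite -expr2 sqrf_eq0 => /eqP.
Qed.

Lemma sqr_normv u : normv u ^+ 2 = dotv u u.
Proof. by rewrite sqr_sqrtr// dotvv_ge0. Qed.

Lemma normv_ge0 u : 0 <= normv u.
Proof. exact: sqrtr_ge0. Qed.

Lemma normv0 : normv (0 : 'rV[R]_d) = 0.
Proof. by rewrite /normv dotv0r sqrtr0. Qed.

Lemma normv_eq0 u : normv u = 0 -> u = 0.
Proof. by move=> u0; apply: dotvv_eq0; rewrite -sqr_normv u0 expr0n. Qed.

Lemma normvZ k u : normv (k *: u) = `|k| * normv u.
Proof.
by rewrite /normv dotvZl dotvZr mulrA -expr2 sqrtrM ?sqr_ge0// sqrtr_sqr.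
Qed.

Lemma normvN u : normv (- u) = normv u.
Proof. by rewrite -scaleN1r normvZ normrN1 mul1r. Qed.

Lemma cauchy_schwarz_sqr u v : dotv u v ^+ 2 <= dotv u u * dotv v v.
Proof.
have [v0|v_neq0] := eqVneq (dotv v v) 0.
  by rewrite (dotvv_eq0 v0) !dotv0r expr0n mulr0.
have v_gt0 : 0 < dotv v v by rewrite lt_neqAle eq_sym v_neq0 dotvv_ge0.
(* This is |v|^2 times the component of [u] orthogonal to [v]. *)
have := dotvv_ge0 (dotv v v *: u - dotv u v *: v).
rewrite !dotvE (dotvC v u) => h.
by rewrite -subr_ge0 -(pmulr_rge0 _ v_gt0); apply: le_trans h _; lra.
Qed.

Lemma cauchy_schwarz u v : `|dotv u v| <= normv u * normv v.
Proof.
rewrite -ler_sqr ?nnegrE ?normr_ge0 ?mulr_ge0 ?normv_ge0//.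
by rewrite real_normK ?num_real// exprMn !sqr_normv cauchy_schwarz_sqr.
Qed.

Lemma dotv_le u v : dotv u v <= normv u * normv v.
Proof. exact: le_trans (ler_norm _) (cauchy_schwarz u v). Qed.

Lemma normvD u v : normv (u + v) <= normv u + normv v.
Proof.
rewrite -ler_sqr ?nnegrE ?addr_ge0 ?normv_ge0// sqrrD !sqr_normv !dotvE.
by rewrite (dotvC v u); have := dotv_le u v; lra.
Qed.

Lemma normv_coord_le u i : `|u 0 i| <= normv u.
Proof.
rewrite -ler_sqr ?nnegrE ?normv_ge0// real_normK ?num_real// sqr_normv.
rewrite /dotv (bigD1 i)//= -expr2 lerDl.
by apply: sumr_ge0 => j _; rewrite -expr2 sqr_ge0.
Qed.

End euclidean_space.

(** * Smooth strongly convex functions *)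

Section smooth_convex.
Context {R : realType} {d : nat}.
Variables (f : 'rV[R]_d -> R) (L mu : R).
Hypotheses (L0 : 0 < L) (fL : lipschitz_grad L f).
Hypotheses (mu0 : 0 < mu) (fmu : strongly_convex mu f).

Lemma strongly_convex_ge x y : f x + dotv (grad f x) (y - x) <= f y.
Proof.
apply: le_trans (fmu x y); rewrite lerDl mulr_ge0 ?sqr_ge0//.
by rewrite divr_ge0// ltW.
Qed.

(* Convexity makes every increment of [f] at most the slope at its endpoint;
   summing over the [n] steps of a uniform subdivision of the segment bounds
   the slopes by an arithmetic progression, whence the factor (n + 1)/(2n). *)
Lemma descent_subdivision x h (n k : nat) :
  f (x + (k%:R / n.+1%:R) *: h) <= f x + k%:R / n.+1%:R * dotv (grad f x) h
    + L * dotv h h * (k%:R * k.+1%:R / 2) / n.+1%:R ^+ 2.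
Proof.
elim: k => [|k IH]; first by rewrite !mul0r scale0r mulr0 !mul0r !addr0.
set xk := x + _ in IH; set xk1 := x + _.
have n0 : 0 < n.+1%:R^-1 :> R by rewrite invr_gt0 ltr0n.
have e1 : xk - xk1 = - (n.+1%:R^-1 *: h).
  rewrite /xk /xk1 opprD addrACA subrr add0r -scalerBl.
  have -> : k%:R / n.+1%:R - k.+1%:R / n.+1%:R = - n.+1%:R^-1 :> R.
    by rewrite -(@natr1 R k); ring.
  by rewrite scaleNr.
have := strongly_convex_ge xk1 xk.
rewrite e1 dotvNr dotvZr.
have e2 : xk1 - x = (k.+1%:R / n.+1%:R) *: h by rewrite /xk1 addrC addKr.
have h1 : dotv (grad f xk1 - grad f x) h <= L * (k.+1%:R / n.+1%:R) * dotv h h.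
  apply: le_trans (dotv_le _ _) _; rewrite -sqr_normv expr2 mulrA.
  apply: ler_wpM2r; first exact: normv_ge0.
  have := fL xk1 x; rewrite e2 normvZ ger0_norm; last exact: divr_ge0.
  by rewrite mulrA.
have h2 : n.+1%:R^-1 * dotv (grad f xk1) h <= n.+1%:R^-1 *
    (dotv (grad f x) h + L * (k.+1%:R / n.+1%:R) * dotv h h).
  by rewrite ler_pM2l// -lerBlDl; move: h1; rewrite dotvDl dotvNl.
move=> h3.
have h4 : f xk1 <= f xk + n.+1%:R^-1 * dotv (grad f xk1) h.
  by rewrite -lerBlDr.
apply: le_trans h4 _; apply: le_trans (lerD IH h2) _.
rewrite -!(@natr1 R k.+1) -!(@natr1 R k) -exprVn.
set m := n.+1%:R^-1; set D := dotv h h; set G := dotv (grad f x) h.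
by rewrite le_eqVlt; apply/orP; left; apply/eqP; field.
Qed.

(** At the end of the segment the subdivision bound carries the factor (n + 2)/(n + 1) in front of
    [L / 2 * dotv h h]; its excess over 1 vanishes as the mesh is refined. *)
Lemma descent x h :
  f (x + h) <= f x + dotv (grad f x) h + L / 2 * dotv h h.
Proof.
set A := f x + dotv (grad f x) h + L / 2 * dotv h h.
have hn n : f (x + h) <= A + L / 2 * dotv h h * n.+1%:R^-1.
  have := descent_subdivision x h n n.+1.
  have nz : n.+1%:R != 0 :> R by rewrite pnatr_eq0.
  rewrite divff// scale1r mul1r => /le_trans; apply.
  rewrite /A -(@natr1 R n.+1) le_eqVlt; apply/orP; left; apply/eqP.
  by field; rewrite ?natr1 ?nz.
apply/ler_addgt0Pr => e e0.
set K := L / 2 * dotv h h in hn.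
have K0 : 0 <= K by rewrite mulr_ge0 ?dotvv_ge0// divr_ge0// ltW.
have [n Kn] : exists n : nat, K / e < n.+1%:R.
  exists (Num.truncn (K / e)); exact: truncnS_gt.
apply: le_trans (hn n) _; rewrite lerD2l.
by rewrite ler_pdivrMr ?ltr0n// mulrC -ler_pdivrMr// ltW.
Qed.

Variable xstar : 'rV[R]_d.
Hypothesis xstar_min : forall x, f xstar <= f x.

(** A gradient step of length 1/L gains at least |grad f|^2 / (2 L), and cannot go below the
    minimum. *)
Lemma sqr_grad_le x : dotv (grad f x) (grad f x) <= 2 * L * (f x - f xstar).
Proof.
have := le_trans (xstar_min _) (descent x (- (L^-1 *: grad f x))).
rewrite !dotvE; set G := dotv _ _ => h.
have LL : L^-1 * L = 1 by rewrite mulVf// gt_eqF.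
have : L^-1 * G <= 2 * (f x - f xstar).
  suff -> : L^-1 * G = 2 * (L^-1 * G - L / 2 * (L^-1 * (L^-1 * G))) by lra.
  by field; rewrite gt_eqF.
move=> /(ler_wpM2l (ltW L0)); rewrite mulrA divff ?gt_eqF//; lra.
Qed.

(** Polyak-Lojasiewicz inequality, by completing the square in the strong convexity bound at
    [xstar]. *)
Lemma sqr_grad_ge x : 2 * mu * (f x - f xstar) <= dotv (grad f x) (grad f x).
Proof.
have := fmu x xstar; rewrite -[x - xstar]opprB normvN sqr_normv.
move: (dotvv_ge0 (grad f x + mu *: (xstar - x))).
rewrite !(dotvDl _ (mu *: _)) !(dotvDr _ _ (mu *: _)) !dotvZl !dotvZr.
rewrite (dotvC (xstar - x)).
set G := dotv _ _; set gh := dotv _ (xstar - x); set H := dotv (xstar - x) _ => h2 h1.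
have : 2 * mu * (f x - f xstar) <= 2 * mu * (- gh - mu / 2 * H).
  by apply: ler_wpM2l; [rewrite mulr_ge0// ltW|lra].
lra.
Qed.

Lemma grad_min : grad f xstar = 0.
Proof.
apply: dotvv_eq0; apply/eqP; rewrite eq_le dotvv_ge0 andbT.
by have := sqr_grad_le xstar; rewrite subrr mulr0.
Qed.

Lemma sqr_dist_le x : normv (x - xstar) ^+ 2 <= 2 / mu * (f x - f xstar).
Proof.
have := fmu xstar x; rewrite grad_min dotv0l addr0.
rewrite -[xstar - x]opprB normvN => h.
by rewrite mulrAC ler_pdivlMr//; lra.
Qed.

End smooth_convex.

(** * Real powers *)

Section real_powers.
Context {R : realType}.
Implicit Types x s z q : R.

Lemma ln_ge_1Binv x : 0 < x -> 1 - x^-1 <= ln x.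
Proof.
move=> x0; have := @le_ln1Dx R (x^-1 - 1).
rewrite addrCA subrr addr0 lnV ?posrE// => h.
by have := h ltac:(rewrite ltrBDl subrr invr_gt0//); lra.
Qed.

(** The factor 2 comes from ln (1 - x) >= - 2 x on [0, 1/2]. It is applied to x = 1/(t + 2), which
    never exceeds 1/2. *)
Lemma powR_1B_ge z x : 0 <= z -> 0 <= x <= 2^-1 -> 1 - 2 * z * x <= (1 - x) `^ z.
Proof.
move=> z0 /andP[x0 x1].
have x1' : 0 < 1 - x by lra.
rewrite /powR gt_eqF//; apply: le_trans (expR_ge1Dx _).
have h : - (2 * x) <= ln (1 - x).
  apply: le_trans (ln_ge_1Binv x1').
  have -> : 1 - (1 - x)^-1 = - (x / (1 - x)) by field; rewrite gt_eqF.
  rewrite lerN2 ler_pdivrMr//.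
  by have := mulr_ge0 x0 (ltac:(lra) : 0 <= 1 - 2 * x); lra.
by have := ler_wpM2l z0 h; lra.
Qed.

Lemma powR_1D_ge q x : 0 <= q -> 0 <= x <= 1 -> 1 + q / 2 * x <= (1 + x) `^ q.
Proof.
move=> q0 /andP[x0 x1].
have x1' : 0 < 1 + x by lra.
rewrite /powR gt_eqF//; apply: le_trans (expR_ge1Dx _).
have h : x / 2 <= ln (1 + x).
  apply: le_trans (ln_ge_1Binv x1').
  have -> : 1 - (1 + x)^-1 = x / (1 + x) by field; rewrite gt_eqF.
  rewrite ler_wpM2l// lef_pV2 ?posrE//; lra.
by have := ler_wpM2l q0 h; lra.
Qed.

(** Telescoping form of the comparison of the sum of the s^(-delta) with a multiple of s^(1 -
    delta). The 1/2 comes from ln (1 + x) >= x / 2 on [0, 1]. *)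
Lemma powR_succ_ge delta s : 0 < delta < 1 -> 1 <= s ->
  s `^ (1 - delta) + (1 - delta) / 2 * s `^ (- delta) <= (s + 1) `^ (1 - delta).
Proof.
move=> /andP[d0 d1] s1; have s0 : 0 < s by lra.
have -> : s + 1 = s * (1 + s^-1) by rewrite mulrDr mulr1 divff// gt_eqF.
rewrite powRM ?addr_ge0 ?invr_ge0 ?(ltW s0)//.
have -> : s `^ (- delta) = s `^ (1 - delta) * s^-1.
  rewrite -(powR_inv1 (ltW s0)) -powRD; last by rewrite (gt_eqF s0) implybT.
  by congr powR; ring.
have -> : s `^ (1 - delta) + (1 - delta) / 2 * (s `^ (1 - delta) * s^-1) =
  s `^ (1 - delta) * (1 + (1 - delta) / 2 * s^-1) by ring.
apply: ler_wpM2l; first exact: powR_ge0.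
apply: powR_1D_ge; first by lra.
by rewrite invr_ge0 (ltW s0)/= invf_le1.
Qed.

End real_powers.

(** * Growth of the averaged nonlinearity: component-wise case *)

(** Near 0 the derivative makes u h(u) at least of order u^2; farther away only monotonicity is left
    and gives order |u|. *)
Lemma odd_nondecreasing_growth {R : realType} (h : R -> R) :
  {homo h : x y / x <= y} -> (forall x, h (- x) = - h x) ->
  derivable h 0 1 -> 0 < h^`()%classic 0 ->
  exists2 c : R, 0 < c & forall u : R, c * Num.min `|u| (u ^+ 2) <= u * h u.
Proof.
move=> hnd hodd hd h'0.
have h0 : h 0 = 0 by have := hodd 0; rewrite oppr0; lra.
set D := h^`()%classic 0 in h'0.
have cvgD : (fun t : R => t^-1 *: (h (t *: 1 + 0) - h 0)) @ 0^' --> D.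
  by rewrite /D derive1E; exact: hd.
have D2 : D / 2 < D by lra.
have [e /= e0 he] := cvgr_gt _ cvgD _ D2.
(* The cap at 1 lets the single constant [D / 2 * xi] serve both ranges of [u]. *)
pose xi := Num.min (e / 2) 1.
have xi0 : 0 < xi by rewrite lt_min ltr01 divr_gt0.
have xie : xi < e by rewrite gt_min; apply/orP; left; lra.
have xi1 : xi <= 1 by rewrite ge_min lexx orbT.
have small u : 0 < u -> u <= xi -> D / 2 * u <= h u.
  move=> u0 uxi; have := he u; rewrite /ball_ /= sub0r normrN gtr0_norm//.
  rewrite gt_eqF// => /(_ ltac:(lra) isT).
  rewrite /GRing.scale /= mulr1 addr0 h0 subr0 ltr_pdivlMl// mulrC.
  exact: ltW.
have pos u : 0 <= u -> D / 2 * xi * Num.min u (u ^+ 2) <= u * h u.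
  rewrite le_eqVlt => /predU1P[<-|u0].
    by rewrite expr0n/= minxx mulr0 mul0r.
  have [uxi|uxi] := leP u xi.
    apply: le_trans (ler_wpM2l (ltW u0) (small u u0 uxi)).
    rewrite mulrCA -mulrA; apply: ler_wpM2l; first by rewrite ltW// divr_gt0.
    apply: (@le_trans _ _ (1 * u ^+ 2)); last by rewrite mul1r expr2.
    apply: ler_pM; rewrite ?(ltW xi0)// ?ge_min ?lexx ?orbT//.
    by rewrite le_min (ltW u0) sqr_ge0.
  have hu : D / 2 * xi <= h u.
    by apply: le_trans (small _ xi0 (lexx _)) _; apply: hnd; exact: ltW.
  apply: (@le_trans _ _ (D / 2 * xi * u)).
    by rewrite ler_wpM2l ?ge_min ?lexx// mulr_ge0// ?ltW// divr_gt0.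
  by rewrite mulrC ler_wpM2l// ltW.
exists (D / 2 * xi); first by rewrite mulr_gt0// divr_gt0.
move=> u; have [u0|u0] := leP 0 u; first by rewrite ger0_norm// pos.
rewrite ltr0_norm//; have := pos (- u); rewrite hodd mulrNN sqrrN; apply.
by rewrite oppr_ge0 ltW.
Qed.

Lemma exists_uniform_lower {R : realType} (d : nat) (Q : 'I_d -> R -> Prop) :
  (forall i c c', Q i c -> c' <= c -> Q i c') ->
  (forall i, exists2 c : R, 0 < c & Q i c) ->
  exists2 c : R, 0 < c & forall i, Q i c.
Proof.
move=> Qle Qex.
have /choice[c hc] : forall i, exists c, 0 < c /\ Q i c.
  by move=> i; have [c c0 Qc] := Qex i; exists c.
(* The seed 1 keeps the minimum positive when there is no index. *)
exists (\big[Num.min/1]_i c i).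
  by apply/bigmin_gtP; split=> // i _; have [] := hc i.
by move=> i; have [_ /Qle] := hc i; apply; exact: bigmin_le.
Qed.

Section componentwise_growth.
Context {R : realType} {d : nat}.

Lemma componentwise_growth (Psi : 'rV[R]_d -> 'rV[R]_d) p (N1 : R -> R) :
  polyak_tsypkin Psi p -> componentwise Psi N1 ->
  exists2 c : R, 0 < c & forall x : 'rV[R]_d,
    c * Num.min (normv x) (normv x ^+ 2) <= dotv (Phi Psi p x) x.
Proof.
move=> PT cw.
have [c c0 hc] : exists2 c : R, 0 < c &
    forall i (u : R), c * Num.min `|u| (u ^+ 2) <= u * phi N1 p i u.
  apply: (@exists_uniform_lower _ _ (fun i c => forall u,
      c * Num.min `|u| (u ^+ 2) <= u * phi N1 p i u)).
    move=> i c c' hc le_c u; apply: le_trans (hc u).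
    by rewrite ler_wpM2r// le_min normr_ge0 sqr_ge0.
  by move=> i; have [? ? ? ?] := PT N1 cw i; exact: odd_nondecreasing_growth.
have PhiE x i : Phi Psi p x 0 i = phi N1 p i (x 0 i).
  by rewrite mxE /phi; congr Rintegral; apply/funext => v; rewrite cw !mxE.
have min_ge0 (u : R) : 0 <= Num.min `|u| (u ^+ 2).
  by rewrite le_min normr_ge0 sqr_ge0.
have sum_ge (x : 'rV[R]_d) i : c * Num.min `|x 0 i| (x 0 i ^+ 2) <= dotv (Phi Psi p x) x.
  rewrite /dotv (bigD1 i)//= PhiE (mulrC (phi _ _ _ _)); apply: le_trans (hc i _) _.
  rewrite lerDl sumr_ge0// => j _; rewrite PhiE (mulrC (phi _ _ _ _)).
  by apply: le_trans (hc j _); rewrite mulr_ge0// ltW.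
exists (c / d.+1%:R); first by rewrite divr_gt0.
move=> x.
have [->|x0] := eqVneq x 0.
  by rewrite normv0 expr0n/= minxx mulr0 dotv0r.
(* Pigeonhole; dividing by [d.+1] instead of [d] makes the contradiction strict and the divisor
   nonzero for every [d]. *)
have [i hi] : exists i, normv x ^+ 2 <= d.+1%:R * x 0 i ^+ 2.
  apply: contrapT => /forallNP hx.
  have : dotv x x <= \sum_(i < d) normv x ^+ 2 / d.+1%:R.
    apply: ler_sum => i _; rewrite ler_pdivlMr ?ltr0n// mulrC -expr2 ltW//.
    by rewrite ltNge; apply/negP/hx.
  rewrite sumr_const card_ord -sqr_normv -[_ *+ d]mulr_natl mulrCA.
  rewrite ler_pMr; last first.
    rewrite exprn_gt0// lt_neqAle normv_ge0 eq_sym andbT.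
    by apply: contraNneq x0 => /normv_eq0 ->.
  by rewrite ler_pdivlMr ?ltr0n// mul1r ler_nat ltnn.
apply: le_trans (sum_ge x i); rewrite -mulrA ler_pM2l// mulrC ler_pdivrMr ?ltr0n//.
have d1 : 1 <= d.+1%:R :> R by rewrite ler1n.
rewrite minr_pMl ?ler0n// le_min; apply/andP; split.
  rewrite ge_min; apply/orP; left.
  rewrite -ler_sqr ?nnegrE ?normv_ge0 ?mulr_ge0// exprMn.
  apply: le_trans hi _; rewrite real_normK ?num_real// mulrC ler_wpM2l ?sqr_ge0//.
  by rewrite expr2 ler_peMr// ler0n.
by rewrite ge_min; apply/orP; right; rewrite mulrC.
Qed.

End componentwise_growth.

(** * Measurability and reflection in R^d *)

Lemma measurable_rV_opp {R : realType} n :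
  measurable_fun [set: 'rV[R]_n] (-%R : 'rV[R]_n -> 'rV[R]_n).
Proof.
apply: measurable_fun_rVP => i; under eq_fun do rewrite mxE.
by apply: measurable_funN; exact: measurable_coord.
Qed.

(** By induction on the dimension: [rV_cons] commutes with the reflections, and the reflected
    product measure agrees with the product measure on rectangles, hence everywhere. *)
Lemma lebesgue_rV_opp {R : realType} n (A : set 'rV[R]_n) : measurable A ->
  lebesgue_rV n (-%R @^-1` A) = lebesgue_rV n A.
Proof.
elim: n A => [|n IH] A mA.
  rewrite /=; have -> : -%R @^-1` A = A; last by [].
  by apply/seteqP; split=> x; rewrite /preimage/= (_ : - x = x)//;
    apply/rowP => -[].
pose opp2 (u : measurableTypeR R * 'rV[R]_n) : measurableTypeR R * 'rV[R]_n :=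
  (- u.1, - u.2).
have mopp2 : measurable_fun setT opp2.
  apply/measurable_fun_pair.
    by apply: measurable_funN; exact: measurable_fst.
  by apply: measurableT_comp; [exact: measurable_rV_opp|exact: measurable_snd].
have oppE : (@rV_cons R n) @^-1` (-%R @^-1` A) = opp2 @^-1` (@rV_cons R n @^-1` A).
  have consN u : rV_cons (opp2 u) = - rV_cons u.
    apply/matrixP => k i; rewrite [RHS]mxE (ord1 k).
    have -> : (0 : 'I_1) = ord0 by exact/val_inj.
    case: (unliftP ord0 i) => [j ->|->]; rewrite ?rV_consS ?rV_cons0//.
    by rewrite mxE.
  by apply/funext => u; rewrite /preimage/= consN.
have mcA : measurable (@rV_cons R n @^-1` A).
  by rewrite -[X in measurable X]setTI; exact: measurable_rV_cons.
rewrite /= /lebesgue_step /pushforward oppE; apply/esym.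
apply: (@product_measure_unique _ _ _ _ _ lebesgue_measure (lebesgue_rV n)
  (pushforward (lebesgue_measure \x lebesgue_rV n)%E opp2)) => //.
move=> B C mB mC; rewrite /pushforward.
rewrite -[LHS]/((lebesgue_measure \x lebesgue_rV n)%E
  (((-%R : R -> R) @^-1` B) `*` ((-%R : 'rV[R]_n -> _) @^-1` C))).
rewrite product_measure1E; last 2 first.
- by rewrite -[X in measurable X]setTI; exact: measurable_funN.
- by rewrite -[X in measurable X]setTI; exact: measurable_rV_opp.
by rewrite IH//; congr (_ * _)%E; exact: lebesgue_measureN.
Qed.

Lemma integral_rV_opp {R : realType} n (g : 'rV[R]_n -> \bar R) :
  measurable_fun setT g ->
  (\int[lebesgue_rV n]_z g (- z)%R = \int[lebesgue_rV n]_z g z)%E.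
Proof.
move=> mg; have oppK (h : 'rV[R]_n -> \bar R) : measurable_fun setT h ->
    (forall z, 0 <= h z)%E ->
    (\int[lebesgue_rV n]_z h (- z)%R = \int[lebesgue_rV n]_z h z)%E.
  move=> mh h0; rewrite -[LHS]/(\int[lebesgue_rV n]_(z in -%R @^-1` setT)
    (h \o -%R) z)%E -ge0_integral_pushforward//; last exact: measurable_rV_opp.
  apply: eq_measure_integral; first exact: measurable_rV_opp.
  by move=> ? A mA _; exact: lebesgue_rV_opp.
rewrite [LHS]integralE [RHS]integralE.
rewrite -[X in (X^\+)%E]/(g \o -%R) -[X in (X^\-)%E]/(g \o -%R).
rewrite funepos_comp funeneg_comp /= !oppK//.
- exact: measurable_funeneg.
- exact: measurable_funepos.
Qed.

Section measurability_rV.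
Context {R : realType} {n : nat}.

Lemma normv_le_coord (u : 'rV[R]_n) b : (forall i, `|u 0 i| <= b) ->
  normv u <= n%:R * b.
Proof.
move=> ub; have [i0|/forallNP n0] := pselect (exists i : 'I_n, True); last first.
  have -> : u = 0 by apply/rowP => i; have := n0 i.
  rewrite normv0; case: (posnP n) => [->|n_gt0]; first by rewrite mul0r.
  by have := n0 (Ordinal n_gt0).
have [i _] := i0; have b0 : 0 <= b := le_trans (normr_ge0 _) (ub i).
have n1 : 1 <= n%:R :> R by rewrite ler1n (leq_ltn_trans _ (ltn_ord i)).
rewrite -ler_sqr ?nnegrE ?normv_ge0 ?mulr_ge0// sqr_normv exprMn.
apply: (@le_trans _ _ (\sum_(j < n) b ^+ 2)).
  apply: ler_sum => j _; rewrite -expr2 -real_normK ?num_real//.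
  by rewrite ler_sqr ?nnegrE.
rewrite sumr_const card_ord -[X in X <= _]mulr_natl ler_wpM2r ?sqr_ge0//.
by rewrite expr2 ler_peMr.
Qed.

(* [h] is the pointwise limit of its compositions with the roundings to the
   grids of mesh 1/(k+1), which have countable range. *)
Lemma measurable_fun_rV_locally_lipschitz (h : 'rV[R]_n -> R) :
  (forall x, exists K, forall y, normv (y - x) <= 1 ->
    `|h y - h x| <= K * normv (y - x)) ->
  measurable_fun setT h.
Proof.
move=> hlip.
pose fl (k : nat) (r : R) : int := Num.floor (k.+1%:R * r).
pose rnd k (x : 'rV[R]_n) : 'rV[R]_n := \row_i ((fl k (x 0 i))%:~R / k.+1%:R).
have rnd_close k x i : `|(rnd k x - x) 0 i| <= k.+1%:R^-1.
  rewrite !mxE; set r := x 0 i; set K := k.+1%:R.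
  have K0 : 0 < K by rewrite ltr0n.
  have -> : (fl k r)%:~R / K - r = ((fl k r)%:~R - K * r) / K.
    by rewrite mulrBl mulrAC divff ?mul1r ?gt_eqF.
  have Ki : 0 <= K^-1 by rewrite invr_ge0 ltW.
  rewrite normrM (ger0_norm Ki) ler_piMl// distrC ger0_norm.
    by rewrite lerBlDl ltW// -[X in _ < _ + X]/(1%:~R) -intrD floorD1_gt.
  by rewrite subr_ge0 ge_floor.
apply: (@measurable_fun_cvg _ _ _ _ (fun k => h \o rnd k)); last first.
  move=> x _; have [K hK] := hlip x.
  apply/cvgrPdist_le => e e0.
  have K1 : 0 < (`|K| + 1) * (n%:R + 1).
    by rewrite mulr_gt0// ltr_wpDl.
  near=> k.
  have k0 : 0 < k.+1%:R :> R by rewrite ltr0n.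
  have ek : (`|K| + 1) * (n%:R + 1) * k.+1%:R^-1 <= Num.min e 1.
    rewrite ler_pdivrMr// -ler_pdivrMl; last by rewrite lt_min e0/=.
    apply: (@le_trans _ _ k%:R); last by rewrite ler_nat.
    by near: k; exact: nbhs_infty_ger.
  have d_le : normv (rnd k x - x) <= n%:R * k.+1%:R^-1.
    by apply: normv_le_coord => i; exact: rnd_close.
  have d_le2 : (`|K| + 1) * normv (rnd k x - x) <= Num.min e 1.
    apply: le_trans ek; rewrite -mulrA ler_wpM2l// ?addr_ge0//.
    by apply: le_trans d_le _; rewrite ler_wpM2r ?invr_ge0// lerDl.
  rewrite /= distrC; apply: le_trans (hK _ _) _.
    apply: (@le_trans _ _ ((`|K| + 1) * normv (rnd k x - x))).
      by rewrite ler_peMl ?normv_ge0// lerDr.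
    by apply: le_trans d_le2 _; rewrite ge_min lexx orbT.
  apply: (@le_trans _ _ ((`|K| + 1) * normv (rnd k x - x))).
    rewrite ler_wpM2r ?normv_ge0//; have := ler_norm K; lra.
  by apply: le_trans d_le2 _; rewrite ge_min lexx.
move=> k _ B mB; rewrite setTI.
(* The preimage is the countable union of the grid cells at whose corner [h] takes a value in
   [B]. *)
pose F (v : 'rV[int]_n) : set 'rV[R]_n :=
  if `[< B (h (\row_i ((v 0 i)%:~R / k.+1%:R))) >]
  then \bigcap_i [set x : 'rV[R]_n | fl k (x 0 i) = v 0 i] else set0.
rewrite (_ : _ @^-1` _ = \bigcup_v F v).
  apply: countable_bigcupT_measurable => [|v]; first exact: countableP.
  rewrite /F; case: ifPn => // _.
  apply: fin_bigcap_measurable => // i _.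
  have mfl : measurable_fun setT (fun x : 'rV[R]_n => (fl k (x 0 i))%:~R : R).
    apply: (@measurableT_comp _ _ _ _ _ _ (fun r : R => (fl k r)%:~R : R)).
      apply: nondecreasing_measurable => // r s rs.
      by rewrite ler_int le_floor// ler_wpM2l.
    exact: measurable_coord.
  have := mfl measurableT [set ((v 0 i)%:~R : R)] (measurable_set1 _).
  rewrite setTI; congr measurable; apply/seteqP; split => x /=.
    by move=> /eqP; rewrite eqr_int => /eqP.
  by move=> ->.
apply/seteqP; split => [x /= Bx|x [v _]].
  exists (\row_i fl k (x 0 i)) => //; rewrite /F.
  have -> : \row_i (((\row_i fl k (x 0 i)) 0 i)%:~R / k.+1%:R) = rnd k x.
    by apply/rowP => i; rewrite !mxE.
  by rewrite asboolT// => i _ /=; rewrite mxE.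
rewrite /F; case: ifPn => // /asboolP Bv xv /=.
suff -> : rnd k x = \row_i ((v 0 i)%:~R / k.+1%:R) by [].
by apply/rowP => i; rewrite !mxE; have /= -> := xv i I.
Unshelve. all: by end_near. Qed.

Lemma measurable_normv : measurable_fun setT (@normv R n).
Proof.
apply: measurable_fun_rV_locally_lipschitz => x; exists 1 => y _; rewrite mul1r.
rewrite ler_norml; apply/andP; split.
  by have := normvD (x - y) y; rewrite subrK -[x - y]opprB normvN; lra.
by rewrite lerBlDr; have := normvD (y - x) x; rewrite subrK.
Qed.

Lemma measurable_dotv {disp} {T : measurableType disp} (u v : T -> 'rV[R]_n) :
  measurable_fun setT u -> measurable_fun setT v ->
  measurable_fun setT (fun w => dotv (u w) (v w)).
Proof.
move=> mu mv; apply: measurable_sum => i; apply: measurable_funM.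
  exact: (measurableT_comp (measurable_coord i) mu).
exact: (measurableT_comp (measurable_coord i) mv).
Qed.

Lemma measurable_rVD {disp} {T : measurableType disp} (u v : T -> 'rV[R]_n) :
  measurable_fun setT u -> measurable_fun setT v ->
  measurable_fun setT (fun w => u w + v w).
Proof.
move=> mu mv; apply: measurable_fun_rVP => i; under eq_fun do rewrite mxE.
apply: measurable_funD.
  exact: (measurableT_comp (measurable_coord i) mu).
exact: (measurableT_comp (measurable_coord i) mv).
Qed.

Lemma measurable_rVZ {disp} {T : measurableType disp} (k : R) (u : T -> 'rV[R]_n) :
  measurable_fun setT u -> measurable_fun setT (fun w => k *: u w).
Proof.
move=> mu; apply: measurable_fun_rVP => i; under eq_fun do rewrite mxE.
apply: measurable_funM => //.
exact: (measurableT_comp (measurable_coord i) mu).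
Qed.

Lemma measurable_rVB {disp} {T : measurableType disp} (u v : T -> 'rV[R]_n) :
  measurable_fun setT u -> measurable_fun setT v ->
  measurable_fun setT (fun w => u w - v w).
Proof.
move=> mu mv; apply: measurable_rVD => //.
by apply: measurableT_comp mv; exact: measurable_rV_opp.
Qed.

Lemma admissible_measurable (Psi : 'rV[R]_n -> 'rV[R]_n) C :
  admissible Psi C -> measurable_fun setT Psi.
Proof.
move=> [[N1 [C1 [cw aN1 _]]]|[N2 [C2 [jt aN2 _]]]]; apply: measurable_fun_rVP => i.
  under eq_fun do rewrite cw mxE.
  apply: (measurableT_comp _ (measurable_coord i)).
  by apply: nondecreasing_measurable => //; exact: N1_nondecreasing aN1.
(* Extended by 0 to the left, r N2(r) is monotone on the whole line, hence measurable. *)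
pose h r := if 0 <= r then r * N2 r else 0.
have h_nd : nondecreasing_fun h.
  move=> r s rs; rewrite /h; have [r0|r0] := leP 0 r.
    have s0 := le_trans r0 rs; rewrite s0.
    by apply: (N2_nondecreasing aN2) => //; rewrite in_itv/= andbT.
  case: ifPn => // s0.
  have := @N2_nondecreasing _ _ _ _ aN2 0 s; rewrite /= mul0r; apply => //;
    by rewrite in_itv/= ?lexx ?s0.
(* At x = 0 both sides vanish because of the factor [x 0 i]. *)
have PsiE x : Psi x 0 i = h (normv x) * normv x `^ (-1) * x 0 i.
  rewrite jt mxE /h normv_ge0 powR_inv1 ?normv_ge0//.
  have [x0|x0] := eqVneq (normv x) 0; last first.
    by rewrite (mulrAC _ _ (normv x)^-1) divff// mul1r.
  by rewrite (normv_eq0 x0) mxE !mulr0.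
under eq_fun do rewrite PsiE.
apply: measurable_funM; last exact: measurable_coord.
apply: measurable_funM.
  apply: (measurableT_comp _ measurable_normv).
  exact: nondecreasing_measurable.
exact: (measurableT_comp (@measurable_powR R (-1)) measurable_normv).
Qed.

(** Tonelli makes the integrals of the positive and negative parts measurable in the parameter. *)
Lemma measurable_Phi (Psi : 'rV[R]_n -> 'rV[R]_n) (p : 'rV[R]_n -> R) :
  measurable_fun setT Psi -> measurable_fun setT p ->
  measurable_fun setT (Phi Psi p).
Proof.
move=> mPsi mp; apply: measurable_fun_rVP => i; under eq_fun do rewrite mxE.
pose F (u : 'rV[R]_n * 'rV[R]_n) := (Psi (u.1 + u.2) 0 i * p u.2)%:E.
have mF : measurable_fun setT F.
  apply/measurable_EFinP; apply: measurable_funM.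
    apply: (measurableT_comp (measurable_coord i)).
    apply: (measurableT_comp mPsi).
    by apply: measurable_rVD; [exact: measurable_fst|exact: measurable_snd].
  by apply: measurableT_comp => //; exact: measurable_snd.
apply: measurableT_comp => //=.
under eq_fun do rewrite integralE.
apply: emeasurable_funB.
  have := @measurable_fun_fubini_tonelli_F _ _ _ _ _ (lebesgue_rV n) (F^\+)%E.
  rewrite /fubini_F => H; apply: (eq_measurable_fun _ _ (H _ _)).
  - by move=> x _; apply: eq_integral => y _; rewrite !funeposE.
  - exact: measurable_funepos.
  - by move=> u; exact: funepos_ge0.
have := @measurable_fun_fubini_tonelli_F _ _ _ _ _ (lebesgue_rV n) (F^\-)%E.
rewrite /fubini_F => H; apply: (eq_measurable_fun _ _ (H _ _)).
- by move=> x _; apply: eq_integral => y _; rewrite !funenegE.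
- exact: measurable_funeneg.
- by move=> u; exact: funeneg_ge0.
Qed.

End measurability_rV.

(** * Growth of the averaged nonlinearity: joint case *)

Lemma Rintegral_sum {disp} {T : measurableType disp} {R : realType}
    (m : {measure set T -> \bar R}) (D : set T) I (s : seq I) (g : I -> T -> R) :
  measurable D -> (forall i, m.-integrable D (EFin \o g i)) ->
  \int[m]_(x in D) (\sum_(i <- s) g i x) = \sum_(i <- s) \int[m]_(x in D) g i x.
Proof.
move=> mD ig; rewrite /Rintegral.
under eq_integral do rewrite -sumEFin.
rewrite integral_sum//= sum_fine//= => i _.
by apply: integrable_fin_num => //; exact: ig.
Qed.

(** A zero integral would force g = 0 almost everywhere on [A], so [A] would be null. *)
Lemma integral_gt0_support {disp} {T : measurableType disp} {R : realType}
    (m : {measure set T -> \bar R}) (A : set T) (g : T -> R) :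
  measurable A -> measurable_fun A g -> (forall x, A x -> 0 < g x) ->
  (0 < m A)%E -> (0 < \int[m]_(x in A) (g x)%:E)%E.
Proof.
move=> mA mg g0 mA0; rewrite lt0e integral_ge0 ?andbT; last first.
  by move=> x Ax; rewrite lee_fin ltW// g0.
apply/eqP => g_0.
have mgE : measurable_fun A (EFin \o g) by exact/measurable_EFinP.
have /(ae_eq_integral_abs _ mA mgE)[B [mB mB0 AB]] :
    (\int[m]_(x in A) `|(EFin \o g) x| = 0)%E.
  rewrite -[RHS]g_0; apply: eq_integral => x; rewrite inE => Ax /=.
  by rewrite gtr0_norm// g0.
move: mA0; rewrite lt0e => /andP[/eqP]; apply: contra_notP => _.
apply/eqP; rewrite eq_le measure_ge0 andbT -mB0 le_measure ?inE// => x Ax.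
by apply: AB => /= /(_ Ax)[]/eqP; rewrite gt_eqF// g0.
Qed.

(** * Pairing the noises z and -z *)

Section symmetrized_joint.
Context {R : realType} {d : nat}.
Variables (N2 : R -> R) (C2 : R).
Hypothesis aN2 : @admissible_N2 R d N2 C2.
Implicit Types x z : 'rV[R]_d.

Let J x : 'rV[R]_d := N2 (normv x) *: x.

(** With x = (u + v)/2 the sum splits into a term controlled by the monotonicity of r N2(r) and a
    term controlled by Cauchy-Schwarz and the sign of [N2]. *)
Lemma joint_pairE x z :
  let u := x + z in let v := x - z in let a := normv u in let b := normv v in
  dotv (J u) x + dotv (J v) x =
  (a - b) * (a * N2 a - b * N2 b) / 2 + (dotv u v + a * b) * (N2 a + N2 b) / 2.
Proof.
move=> u v a b.
have xE : x = 2^-1 *: (u + v).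
  by apply/rowP => i; rewrite !mxE; field.
have JE w : dotv (J w) x = N2 (normv w) * (dotv w u + dotv w v) / 2.
  by rewrite /J dotvZl [in LHS]xE dotvZr dotvDr; ring.
rewrite !JE -/a -/b -(sqr_normv u) -(sqr_normv v) -/a -/b (dotvC v u).
by field.
Qed.

Lemma joint_mono_ge0 a b : 0 <= a -> 0 <= b ->
  0 <= (a - b) * (a * N2 a - b * N2 b).
Proof.
move=> a0 b0.
wlog ab : a b a0 b0 / b <= a => [H|].
  have [/H->//|/ltW /H] := leP b a.
  by rewrite -[a - b]opprB -[a * _ - _]opprB mulrNN; apply.
rewrite mulr_ge0 ?subr_ge0//.
by apply: (N2_nondecreasing aN2) => //; rewrite in_itv/= andbT.
Qed.

Lemma dot_normv_ge0 x z : 0 <= dotv x z + normv x * normv z.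
Proof.
by have := cauchy_schwarz x z; rewrite ler_norml => /andP[h _]; lra.
Qed.

Lemma joint_pair_ge0 x z : 0 <= dotv (J (x + z)) x + dotv (J (x - z)) x.
Proof.
rewrite joint_pairE; set a := normv (x + z); set b := normv (x - z).
rewrite -mulrDl divr_ge0// addr_ge0 ?joint_mono_ge0 ?normv_ge0//.
(* [N2 0] has no prescribed sign, so vanishing norms are treated apart. *)
have [a0|a0] := eqVneq a 0.
  by rewrite a0 (normv_eq0 a0) dotv0l mul0r addr0 mul0r.
have [b0|b0] := eqVneq b 0.
  by rewrite b0 (normv_eq0 b0) dotv0r mulr0 addr0 mul0r.
rewrite mulr_ge0 ?dot_normv_ge0// addr_ge0// ltW// (N2_gt0 aN2)//;
  by rewrite lt_neqAle normv_ge0 eq_sym ?a0 ?b0.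
Qed.

(* The directions [z] making an angle of at least 30 degrees with the line of
   [x] carry the growth of [Phi]. *)
Lemma joint_pair_ge x z r : x != 0 -> normv z <= r ->
  4 * dotv x z ^+ 2 <= 3 * dotv x x * dotv z z ->
  dotv x x * N2 (normv x + r) / 2 <= dotv (J (x + z)) x + dotv (J (x - z)) x.
Proof.
move=> x0 zr cone.
have X0 : 0 < dotv x x.
  rewrite lt_neqAle dotvv_ge0 andbT eq_sym.
  by apply: contraNneq x0 => /dotvv_eq0 ->.
rewrite joint_pairE; set a := normv (x + z); set b := normv (x - z).
have ab0 : 0 <= a * b by rewrite mulr_ge0 ?normv_ge0.
have uvE : dotv (x + z) (x - z) = dotv x x - dotv z z.
  by rewrite !dotvE (dotvC z); ring.
have abE : (a * b) ^+ 2 = (dotv x x + dotv z z) ^+ 2 - 4 * dotv x z ^+ 2.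
  by rewrite exprMn !sqr_normv !dotvE (dotvC z x); ring.
(* With X = |x|^2 and Z = |z|^2, the cone condition gives (a b)^2 >= X^2 - X Z + Z^2 >= (Z - X /
   2)^2. *)
have ab_ge : dotv z z - dotv x x / 2 <= a * b.
  have [h|h] := leP (dotv z z - dotv x x / 2) 0; first exact: le_trans h ab0.
  rewrite -ler_sqr ?nnegrE ?(ltW h)// abE.
  by have := sqr_ge0 (dotv x x); rewrite !expr2 in cone *; lra.
have key : dotv x x / 2 <= dotv (x + z) (x - z) + a * b by rewrite uvE; lra.
have a_neq0 : a != 0.
  apply: contraTneq key => a0.
  by rewrite a0 (normv_eq0 a0) dotv0l mul0r addr0 -ltNge divr_gt0.
have b_neq0 : b != 0.
  apply: contraTneq key => b0.
  by rewrite b0 (normv_eq0 b0) dotv0r mulr0 addr0 -ltNge divr_gt0.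
have a0 : 0 < a by rewrite lt_neqAle normv_ge0 eq_sym a_neq0.
have b0 : 0 < b by rewrite lt_neqAle normv_ge0 eq_sym b_neq0.
have r0 : 0 <= r := le_trans (normv_ge0 _) zr.
have a_le : a <= normv x + r.
  by apply: le_trans (normvD _ _) _; rewrite lerD2l.
have b_le : b <= normv x + r.
  by apply: le_trans (normvD _ _) _; rewrite normvN lerD2l.
set m := N2 (normv x + r).
have m0 : 0 < m by rewrite (N2_gt0 aN2)//; exact: lt_le_trans a_le.
have Na : m <= N2 a.
  by apply: (N2_nonincreasing aN2) => //; rewrite in_itv/= andbT//; exact: lt_le_trans a_le.
have Nb : m <= N2 b.
  by apply: (N2_nonincreasing aN2) => //; rewrite in_itv/= andbT//; exact: lt_le_trans a_le.
have h1 := joint_mono_ge0 (ltW a0) (ltW b0).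
have h2 : dotv x x / 2 * (m + m) <= (dotv (x + z) (x - z) + a * b) * (N2 a + N2 b).
  apply: ler_pM => //; [by rewrite divr_ge0// ltW|by rewrite addr_ge0// ltW|].
  exact: lerD.
lra.
Qed.

(** For |x| <= 1 it suffices that [N2] is non-increasing. For s = |x| > 1, monotonicity of r N2(r)
    and s + r <= (1 + r) s give N2(1 + r) <= s N2(s + r). *)
Lemma joint_radial_ge x r : 0 < r ->
  N2 (1 + r) * Num.min (normv x) (normv x ^+ 2) <= dotv x x * N2 (normv x + r).
Proof.
move=> r0; rewrite -sqr_normv; set s := normv x.
have s0 : 0 <= s := normv_ge0 x.
have [s1|s1] := leP s 1.
  rewrite mulrC; apply: ler_pM.
  - by rewrite le_min s0 sqr_ge0.
  - by rewrite ltW// (N2_gt0 aN2)// addr_gt0.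
  - by rewrite ge_min lexx orbT.
  - by apply: (N2_nonincreasing aN2); rewrite ?in_itv/= ?andbT; lra.
have h : (1 + r) * N2 (1 + r) <= (s + r) * N2 (s + r).
  apply: (N2_nondecreasing aN2); rewrite ?in_itv/= ?andbT; lra.
have N1r : 0 < N2 (1 + r) by rewrite (N2_gt0 aN2)// addr_gt0.
have Nsr : 0 < N2 (s + r) by rewrite (N2_gt0 aN2)//; lra.
have h2 : N2 (1 + r) <= s * N2 (s + r).
  rewrite -(ler_pM2l (_ : 0 < 1 + r)); last lra.
  apply: le_trans h _; rewrite mulrA ler_wpM2r ?(ltW Nsr)//.
  by have := mulr_ge0 (ltW r0) (ltW (ltac:(lra) : 0 < s - 1)); lra.
apply: (@le_trans _ _ (N2 (1 + r) * s)).
  by rewrite ler_wpM2l ?(ltW N1r)// ge_min lexx.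
by rewrite mulrC expr2 -mulrA ler_wpM2l.
Qed.

End symmetrized_joint.

(** * Boxes around points of the coordinate axes *)

Section boxes.
Context {R : realType} {d : nat}.
Implicit Types c x z : 'rV[R]_d.

(** Boxes are preferred to balls because their Lebesgue measure is a product of lengths. *)
Definition open_box c (e : R) : set 'rV[R]_d :=
  [set z | forall j, `](c 0 j - e), (c 0 j + e)[%classic (z ord0 j)].

Lemma open_boxP c e z : open_box c e z -> forall j, `|(z - c) 0 j| <= e.
Proof.
move=> zc j; have := zc j; rewrite /= in_itv/= !mxE => /andP[h1 h2].
by rewrite ler_norml; apply/andP; split; lra.
Qed.

Lemma measurable_open_box c e : measurable (open_box c e).
Proof.
rewrite [X in measurable X](_ : _ =
    \bigcap_j ((fun z => z ord0 j) @^-1` `](c 0 j - e), (c 0 j + e)[%classic)).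
  apply: fin_bigcap_measurable => // j _.
  by rewrite -[X in measurable X]setTI; exact: measurable_coord.
by apply/seteqP; split=> z /= zc j => [_|]; exact: zc.
Qed.

Lemma lebesgue_open_box_gt0 c e : 0 < e -> (0 < lebesgue_rV d (open_box c e))%E.
Proof.
move=> e0; rewrite /open_box.
rewrite (@lebesgue_rV_box _ _ (fun j => `](c 0 j - e), (c 0 j + e)[%classic))//.
under eq_bigr => j _.
  rewrite lebesgue_measure_itv/= lte_fin ltrBlDr -addrA ltrDl addr_gt0//.
  rewrite -EFinD (_ : _ - _ = e + e); last by ring.
  over.
by rewrite prodEFin lte_fin prodr_gt0// => j _; rewrite addr_gt0.
Qed.

Lemma dotv_delta x i : dotv x (delta_mx 0 i) = x 0 i.
Proof.
rewrite /dotv (bigD1 i)//= mxE !eqxx mulr1 big1 ?addr0// => j ji.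
by rewrite mxE (negbTE ji) andbF mulr0.
Qed.

Lemma near_axis_norm z i r : 0 < r ->
  open_box (r *: delta_mx 0 i) (r / (20 * d%:R)) z ->
  normv (z - r *: delta_mx 0 i) <= r / 20.
Proof.
move=> r0 /open_boxP/normv_le_coord/le_trans; apply.
have d0 : 0 < d%:R :> R by rewrite ltr0n (leq_ltn_trans _ (ltn_ord i)).
by rewrite le_eqVlt; apply/orP; left; apply/eqP; field; rewrite gt_eqF.
Qed.

(** A point at distance at most r/20 from r e_i loses less than the 15 degrees between the 45
    degrees of the axis and the 30 degrees of the cone. In units of r^2 |x|^2 the margin is 4 (5/8 +
    5/400) = 2.55 against 3 * 9/10 = 2.7. *)
Lemma near_axis_cone x z i r : 0 < r -> 2 * x 0 i ^+ 2 <= dotv x x ->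
  open_box (r *: delta_mx 0 i) (r / (20 * d%:R)) z ->
  normv z <= 2 * r /\ 4 * dotv x z ^+ 2 <= 3 * dotv x x * dotv z z.
Proof.
move=> r0 xi /(near_axis_norm r0).
set e := z - _ => eta.
have zE : z = r *: delta_mx 0 i + e by rewrite /e addrC subrK.
clearbody e.
have delta1 : dotv (delta_mx 0 i : 'rV[R]_d) (delta_mx 0 i) = 1.
  by rewrite dotv_delta mxE !eqxx.
have ee : dotv e e <= (r / 20) ^+ 2.
  by rewrite -sqr_normv ler_sqr ?nnegrE ?normv_ge0// divr_ge0// ltW.
have ei : `|e 0 i| <= r / 20 := le_trans (normv_coord_le _ _) eta.
have xe : dotv x e ^+ 2 <= dotv x x * (r / 20) ^+ 2.
  by apply: le_trans (cauchy_schwarz_sqr _ _) _; rewrite ler_wpM2l ?dotvv_ge0.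
split.
  rewrite zE; apply: le_trans (normvD _ _) _.
  rewrite normvZ /normv delta1 sqrtr1 mulr1 gtr0_norm// -/(normv e); lra.
have zz : 9 / 10 * r ^+ 2 <= dotv z z.
  rewrite zE !dotvE delta1 dotv_delta (dotvC _ e) dotv_delta.
  have := dotvv_ge0 e; move: ei; rewrite ler_norml => /andP[e1 _].
  have := ler_wpM2l (ltW r0) e1; lra.
(* Weighted form (s + t)^2 <= (5/4) s^2 + 5 t^2, whose defect is (s - 4 t)^2 / 4. *)
have xz : dotv x z ^+ 2 <= 5 / 4 * r ^+ 2 * x 0 i ^+ 2 + 5 * dotv x e ^+ 2.
  rewrite zE dotvDr dotvZr dotv_delta -subr_ge0.
  have := sqr_ge0 (r * x 0 i - 4 * dotv x e); lra.
have h1 : r ^+ 2 * (2 * x 0 i ^+ 2) <= r ^+ 2 * dotv x x.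
  by rewrite ler_wpM2l ?sqr_ge0.
have h2 := ler_wpM2l (dotvv_ge0 x) zz.
move: xe; rewrite (_ : (r / 20) ^+ 2 = r ^+ 2 / 400); last by field.
have h3 := mulr_ge0 (dotvv_ge0 x) (sqr_ge0 r).
lra.
Qed.

End boxes.

Section joint_growth.
Context {R : realType} {d : nat} {disp : measure_display}.
Context {T : measurableType disp} (P : probability T R).
Variables (z : nat -> {RV P >-> 'rV[R]_d}) (p : 'rV[R]_d -> R).
Hypothesis zp : noise_assumption z p.

Lemma integrable_density : (lebesgue_rV d).-integrable setT (EFin \o p).
Proof.
apply/integrableP; split.
  by apply/measurable_EFinP; exact: noise_density_measurable zp.
rewrite (_ : (fun x => `|(EFin \o p) x|)%E = EFin \o p); last first.
  by apply/funext => x /=; rewrite ger0_norm// (noise_density_ge0 zp).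
rewrite -(noise_density zp 0 measurableT).
by rewrite /distribution /pushforward preimage_setT probability_setT ltry.
Qed.

Lemma integrable_bounded_density (g : 'rV[R]_d -> R) M : measurable_fun setT g ->
  (forall u, `|g u| <= M) ->
  (lebesgue_rV d).-integrable setT (EFin \o (fun u => g u * p u)).
Proof.
move=> mg gM.
have := integrableZl measurableT M integrable_density; apply: le_integrable => //.
  apply/measurable_EFinP; apply: measurable_funM => //.
  exact: noise_density_measurable zp.
move=> u _; rewrite /= lee_fin !normrM.
rewrite ler_wpM2r//; exact: le_trans (gM u) (ler_norm _).
Qed.

Lemma Phi_dotE (Psi : 'rV[R]_d -> 'rV[R]_d) C x : measurable_fun setT Psi ->
  (forall u, normv (Psi u) <= C) ->
  dotv (Phi Psi p x) x = \int[lebesgue_rV d]_u (dotv (Psi (x + u)) x * p u).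
Proof.
move=> mPsi PsiC.
have mPsix : measurable_fun setT (fun u => Psi (x + u)).
  by apply: (measurableT_comp mPsi); exact: measurable_rVD.
have ig i : (lebesgue_rV d).-integrable setT
    (EFin \o (fun u => Psi (x + u) 0 i * p u)).
  apply: (@integrable_bounded_density (fun u => Psi (x + u) 0 i) C).
    exact: (measurableT_comp (measurable_coord i) mPsix).
  by move=> u; exact: le_trans (normv_coord_le _ _) (PsiC _).
transitivity (\sum_(i < d) \int[lebesgue_rV d]_u (x 0 i * (Psi (x + u) 0 i * p u))).
  by apply: eq_bigr => i _; rewrite mxE mulrC -RintegralZl.
rewrite -Rintegral_sum//; last first.
  by move=> i; exact: (integrableZl measurableT (x 0 i) (ig i)).
apply: eq_Rintegral => u _; rewrite mulr_suml; apply: eq_bigr => i _; ring.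
Qed.

(* Averaging over [u] and [- u] makes the integrand nonnegative. For every [x]
   some axis makes an angle of at least 45 degrees with it, so only finitely
   many boxes around points of the axes are needed to bound the integral below
   uniformly in the direction of [x]. *)
Lemma joint_growth (Psi : 'rV[R]_d -> 'rV[R]_d) N2 C : (1 < d)%N ->
  joint Psi N2 -> @admissible_N2 R d N2 C ->
  exists2 c : R, 0 < c & forall x : 'rV[R]_d,
    c * Num.min (normv x) (normv x ^+ 2) <= dotv (Phi Psi p x) x.
Proof.
move=> d1 jt aN2.
have mPsi : measurable_fun setT Psi.
  by apply: (@admissible_measurable _ _ _ C); right; exists N2, C.
have PsiC u : normv (Psi u) <= C by rewrite jt; exact: (N2_bounded aN2).
have mp := noise_density_measurable zp.
have [B0 B00 pB] := noise_positive zp.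
(* The boxes lie in the ball of radius 2 r = B0, where the density is positive. *)
pose r := B0 / 2; have r0 : 0 < r by rewrite divr_gt0.
have d0 : 0 < d%:R :> R by rewrite ltr0n (ltn_trans _ d1).
pose A (i : 'I_d) := open_box (r *: delta_mx 0 i) (r / (20 * d%:R)).
have mA i : measurable (A i) by exact: measurable_open_box.
have [q q0 Aq] : exists2 q : R, 0 < q & forall i,
    (q%:E <= \int[lebesgue_rV d]_(u in A i) (p u)%:E)%E.
  apply: (@exists_uniform_lower _ _ (fun i q =>
      (q%:E <= \int[lebesgue_rV d]_(u in A i) (p u)%:E)%E)).
    by move=> i c c' h cc'; apply: le_trans h; rewrite lee_fin.
  move=> i; have Afin : (\int[lebesgue_rV d]_(u in A i) (p u)%:E \is a fin_num)%E.
    apply: integrable_fin_num => //.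
    by apply: integrableS integrable_density.
  exists (fine (\int[lebesgue_rV d]_(u in A i) (p u)%:E)%E); last by rewrite fineK.
  rewrite -lte_fin fineK//; apply: integral_gt0_support => //.
  - exact: measurable_funTS.
  - move=> u Au; apply: pB.
    (* Used at x = 0 for the norm bound alone. *)
    have [|nu _] := @near_axis_cone _ _ 0 u i r r0 _ Au.
      by rewrite mxE expr0n mulr0 dotv0r.
    by apply: le_trans nu _; rewrite /r; lra.
  - by apply: lebesgue_open_box_gt0; rewrite divr_gt0// mulr_gt0.
have N1B0 : 0 < N2 (1 + B0) by rewrite (N2_gt0 aN2)// addr_gt0.
(* One factor 1/2 comes from the symmetrization, the other from [joint_pair_ge]. *)
exists (N2 (1 + B0) * q / 4); first by rewrite divr_gt0// mulr_gt0.
move=> x.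
have [->|x0] := eqVneq x 0.
  by rewrite normv0 expr0n/= minxx mulr0 dotv0r.
pose g (u : 'rV[R]_d) := dotv (Psi (x + u)) x.
have mg : measurable_fun setT g.
  apply: measurable_dotv => //; apply: (measurableT_comp mPsi).
  exact: measurable_rVD.
have gM u : `|g u| <= C * normv x.
  by apply: le_trans (cauchy_schwarz _ _) _; rewrite ler_wpM2r ?normv_ge0.
have mgN : measurable_fun setT (fun u : 'rV[R]_d => g (- u)).
  by apply: (measurableT_comp mg); exact: measurable_rV_opp.
have ig := integrable_bounded_density mg gM.
have igN := integrable_bounded_density mgN (fun u : 'rV[R]_d => gM (- u)).
have symE : \int[lebesgue_rV d]_u (g (- u) * p u) = \int[lebesgue_rV d]_u (g u * p u).
  rewrite /Rintegral; congr fine.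
  rewrite -(@integral_rV_opp _ _ (fun u : 'rV[R]_d => (g u * p u)%:E)).
    by apply: eq_integral => u _; rewrite (noise_symmetric zp).
  by apply/measurable_EFinP; exact: measurable_funM.
pose h (u : 'rV[R]_d) := g u * p u + g (- u) * p u.
have hE u : h u = (g u + g (- u)) * p u by rewrite mulrDl.
have g_pair u : g u + g (- u) = dotv (N2 (normv (x + u)) *: (x + u)) x +
    dotv (N2 (normv (x - u)) *: (x - u)) x by rewrite /g !jt.
have h0 u : 0 <= h u.
  by rewrite hE mulr_ge0 ?(noise_density_ge0 zp)// g_pair (joint_pair_ge0 aN2).
have ih : (lebesgue_rV d).-integrable setT (EFin \o h).
  by rewrite (_ : EFin \o h = (EFin \o (fun u => (g u * p u)%R)) \+
    (EFin \o (fun u => (g (- u) * p u)%R)))%E//; exact: integrableD.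
have IE : 2 * dotv (Phi Psi p x) x = \int[lebesgue_rV d]_u h u.
  by rewrite (Phi_dotE _ mPsi PsiC) RintegralD// symE; lra.
(* Of two distinct coordinates, the smaller square is at most half of |x|^2. *)
have [i xi] : exists i : 'I_d, 2 * x 0 i ^+ 2 <= dotv x x.
  pose i0 : 'I_d := Ordinal (ltn_trans (ltnSn 0) d1).
  pose i1 : 'I_d := Ordinal d1.
  have le2 : x 0 i0 ^+ 2 + x 0 i1 ^+ 2 <= dotv x x.
    rewrite /dotv (bigD1 i0)//= (bigD1 i1)//= -!expr2 lerD2l lerDl.
    by apply: sumr_ge0 => j _; rewrite -expr2 sqr_ge0.
  have [le01|le10] := leP (x 0 i0 ^+ 2) (x 0 i1 ^+ 2).
    by exists i0; lra.
  by exists i1; lra.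
pose k := dotv x x * N2 (normv x + B0) / 2.
have k0 : 0 <= k.
  rewrite divr_ge0// mulr_ge0 ?dotvv_ge0// ltW// (N2_gt0 aN2)//.
  by rewrite ltr_wpDl ?normv_ge0.
have kq : k * q <= 2 * dotv (Phi Psi p x) x.
  rewrite IE -lee_fin /Rintegral fineK; last exact: integrable_fin_num.
  apply: (@le_trans _ _ (\int[lebesgue_rV d]_(u in A i) (h u)%:E)%E); last first.
    apply: ge0_subset_integral => //; last by move=> u _; rewrite lee_fin.
    by have /integrableP[] := ih.
  apply: (@le_trans _ _ (\int[lebesgue_rV d]_(u in A i) (k%:E * (p u)%:E))%E).
    rewrite ge0_integralZl_EFin//; last 2 first.
    - by move=> u _; rewrite lee_fin (noise_density_ge0 zp).
    - by apply/measurable_EFinP; exact: measurable_funTS.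
    by rewrite EFinM lee_wpmul2l// lee_fin.
  apply: ge0_le_integral => //.
  - by move=> u _; rewrite -EFinM lee_fin mulr_ge0 ?(noise_density_ge0 zp).
  - apply/measurable_EFinP; apply: measurable_funM => //; exact: measurable_funTS.
  - by apply: measurable_funTS; have /integrableP[] := ih.
  move=> u Au; rewrite -EFinM lee_fin hE ler_wpM2r ?(noise_density_ge0 zp)//.
  rewrite g_pair /k; have [nu cone] := near_axis_cone r0 xi Au.
  apply: (joint_pair_ge aN2) => //.
  by apply: le_trans nu _; rewrite /r; lra.
have := ler_wpM2r (ltW q0) (joint_radial_ge aN2 x B00).
rewrite /k in kq; lra.
Qed.

End joint_growth.

(** * Conditional expectations and the filtration *)

Section conditional_expectation.
Context {R : realType} {disp : measure_display} {T : measurableType disp}.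
Variable P : probability T R.

(* The inequality [W <= U] is transported from the events of [G] to the weight
   [V] by slicing the range of [V] into intervals of length [e]. *)
Lemma cond_exp_weight_le (G : set (set T)) (Y W : T -> \bar R) (U V : T -> R) :
  (forall A, G A -> measurable A) ->
  measurable_fun setT Y -> (forall w, 0 <= Y w)%E ->
  is_cond_exp P G Y W ->
  measurable_fun setT U -> (forall w, 0 <= U w) ->
  (\int[P]_w (U w)%:E < +oo)%E ->
  {ae P, forall w, (W w <= (U w)%:E)%E} ->
  measurable_wrt G V -> (forall w, 0 <= V w) ->
  (\int[P]_w ((V w)%:E * Y w) <= \int[P]_w (V w * U w)%:E)%E.
Proof.
move=> Gm mY Y0 [GW W0 WY] mU U0 Ufin WU GV V0.
have mV : measurable_fun setT V by move=> _ A mA; rewrite setTI; exact/Gm/GV.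
have mW : measurable_fun setT W by move=> _ A mA; rewrite setTI; exact/Gm/GW.
have mUE : measurable_fun setT (EFin \o U) by exact/measurable_EFinP.
have mVE : measurable_fun setT (EFin \o V) by exact/measurable_EFinP.
have slice e : 0 < e -> (\int[P]_w ((V w)%:E * Y w) <=
    \int[P]_w (V w * U w)%:E + e%:E * \int[P]_w (U w)%:E)%E.
  move=> e0.
  pose A (k : nat) := V @^-1` `[k%:R * e, k.+1%:R * e[%classic.
  have GA k : G (A k) by apply: GV; exact: measurable_itv.
  have mA k : measurable (A k) by exact: Gm.
  have AT : \bigcup_k A k = setT.
    apply/seteqP; split=> // w _; exists (Num.truncn (V w / e)) => //.
    rewrite /A /= in_itv/= -ler_pdivlMr// -ltr_pdivrMr//.
    by rewrite truncn_itv// divr_ge0// ltW.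
  have tA : trivIset setT A.
    apply/trivIsetP => i j _ _; apply: contra_neqP => /eqP/set0P[w []].
    rewrite /A /= !in_itv/= => /andP[i1 i2] /andP[j1 j2].
    have ij1 := le_lt_trans i1 j2; have ji1 := le_lt_trans j1 i2.
    move: ij1 ji1; rewrite !ltr_pM2r// !ltr_nat !ltnS => ij ji.
    by apply/eqP; rewrite eqn_leq ij ji.
  have mVY : measurable_fun setT (fun w => (V w)%:E * Y w)%E.
    exact: emeasurable_funM.
  have mVU : measurable_fun setT (fun w => ((V w + e) * U w)%:E).
    apply/measurable_EFinP; apply: measurable_funM => //.
    exact: measurable_funD.
  have -> : (\int[P]_w (V w * U w)%:E + e%:E * \int[P]_w (U w)%:E =
      \int[P]_w ((V w + e) * U w)%:E)%E.
    rewrite -ge0_integralZl_EFin//; last 2 first.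
    - by move=> w _; rewrite lee_fin.
    - by rewrite ltW.
    rewrite -ge0_integralD//.
    - by apply: eq_integral => w _; rewrite -EFinM -EFinD mulrDl.
    - by move=> w _; rewrite lee_fin mulr_ge0.
    - by apply/measurable_EFinP; exact: measurable_funM.
    - by move=> w _; rewrite -EFinM lee_fin mulr_ge0// ltW.
    - exact: measurable_funeM.
  have sliceE (h : T -> \bar R) : measurable_fun setT h ->
      (forall w, 0 <= h w)%E ->
      integral P setT h = (\sum_(k <oo) integral P (A k) h)%E.
    move=> mh h0; rewrite -AT; apply: ge0_integral_bigcup => //.
    exact: measurable_funTS.
  rewrite (sliceE _ mVY); last by move=> w; rewrite mule_ge0// lee_fin.
  rewrite (sliceE _ mVU); last first.
    by move=> w; rewrite lee_fin mulr_ge0// addr_ge0// ltW.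
  apply: lee_nneseries => [k _ _|k _].
    by apply: integral_ge0 => w _; rewrite mule_ge0// lee_fin.
  have ke0 : 0 <= k.+1%:R * e by rewrite mulr_ge0// ltW.
  (* The constant (k + 1) e dominates [V] on the slice and can be pulled out of the conditional
     expectation; returning to [V] costs at most e U. *)
  apply: (@le_trans _ _ (\int[P]_(w in A k) ((k.+1%:R * e)%:E * Y w))%E).
    apply: ge0_le_integral => //.
    - by move=> w _; rewrite mule_ge0// lee_fin.
    - exact: measurable_funTS.
    - by apply: measurable_funeM; exact: measurable_funTS.
    move=> w; rewrite /A /= in_itv/= => /andP[_ /ltW wk].
    by rewrite lee_wpmul2r// lee_fin.
  rewrite ge0_integralZl_EFin//; last exact: measurable_funTS.
  rewrite -WY//.
  apply: (@le_trans _ _ ((k.+1%:R * e)%:E * \int[P]_(w in A k) (U w)%:E)%E).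
    apply: lee_wpmul2l; first by rewrite lee_fin.
    apply: ae_ge0_le_integral => //.
    - exact: measurable_funTS.
    - by move=> w _; rewrite lee_fin.
    - exact: measurable_funTS.
    by apply: filterS WU => w + _.
  rewrite -ge0_integralZl_EFin//; last 2 first.
  - by move=> w _; rewrite lee_fin.
  - exact: measurable_funTS.
  apply: ge0_le_integral => //.
  - by move=> w _; rewrite -EFinM lee_fin mulr_ge0.
  - by apply: measurable_funeM; exact: measurable_funTS.
  - exact: measurable_funTS.
  move=> w; rewrite /A /= in_itv/= => /andP[wk _].
  rewrite -EFinM lee_fin ler_wpM2r// -(@natr1 R k) mulrDl mul1r lerD2r//.
have IU0 : (0 <= \int[P]_w (U w)%:E)%E.
  by apply: integral_ge0 => w _; rewrite lee_fin.
have IUE : (\int[P]_w (U w)%:E = (fine (\int[P]_w (U w)%:E))%:E)%E.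
  by rewrite fineK// ge0_fin_numE.
apply/lee_addgt0Pr => e e0.
set I := fine _ in IUE.
have I0 : 0 <= I by rewrite fine_ge0.
(* Slices this thin keep the total error e I / (I + 1) below e. *)
have eI : 0 < e / (I + 1) by rewrite divr_gt0// ltr_wpDl.
apply: le_trans (slice _ eI) _.
rewrite leeD2l// IUE -EFinM lee_fin mulrAC ler_pdivrMr ?ltr_wpDl//.
by rewrite ler_pM2l// lerDl.
Qed.

End conditional_expectation.

Section filtration.
Context {R : realType} {d : nat} {disp : measure_display}.
Context {T : measurableType disp} (P : probability T R).
Variable z : nat -> {RV P >-> 'rV[R]_d}.

Lemma filtration_measurable t (A : set T) : filtration z t A -> measurable A.
Proof.
apply: smallest_sub; first exact: sigma_algebra_measurable.
move=> _ [s _ [B mB <-]]; exact: measurable_funP.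
Qed.

Lemma filtration_le s t : (s <= t)%N -> filtration z s `<=` filtration z t.
Proof.
move=> st; apply: sub_sigma_algebra2 => A [r /= rs zA].
by exists r => //=; exact: leq_trans rs st.
Qed.

(** Packaging the filtration as a measurable type on [T] makes the composition lemmas for
    [measurable_fun] available for adapted maps. *)
Definition past t := g_sigma_algebraType
  (\bigcup_(s in `I_t) preimage_set_system setT (z s) measurable).

Lemma measurable_past_filtration t disp' (T' : measurableType disp')
    (X : T -> T') :
  measurable_fun setT (X : past t -> T') -> measurable_wrt (filtration z t) X.
Proof. by move=> mX B mB; have := mX measurableT B mB; rewrite setTI. Qed.

Lemma measurable_past_le s t disp' (T' : measurableType disp') (X : T -> T') :
  (s <= t)%N -> measurable_fun setT (X : past s -> T') ->
  measurable_fun setT (X : past t -> T').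
Proof.
by move=> st mX _ B mB; apply: (filtration_le st); exact: mX.
Qed.

Lemma measurable_past_noise t :
  measurable_fun setT (z t : past t.+1 -> 'rV[R]_d).
Proof.
by move=> _ B mB; apply: sub_sigma_algebra; exists t => //=; exists B.
Qed.

Lemma measurable_past_ambient t disp' (T' : measurableType disp') (X : T -> T') :
  measurable_fun setT (X : past t -> T') -> measurable_fun setT X.
Proof.
by move=> mX _ B mB; apply: (@filtration_measurable t); exact: mX.
Qed.

Lemma measurable_sgd f (Psi : 'rV[R]_d -> 'rV[R]_d) alpha x0 t :
  measurable_fun setT (grad f) -> measurable_fun setT Psi ->
  measurable_fun setT (sgd z f Psi alpha x0 t : past t -> 'rV[R]_d).
Proof.
move=> mgrad mPsi; elim: t => [|t IH]; first exact: measurable_cst.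
have mx := measurable_past_le (leqnSn t) IH.
apply: measurable_rVB => //; apply: measurable_rVZ.
apply: (measurableT_comp mPsi); apply: measurable_rVD.
  exact: (measurableT_comp mgrad mx).
exact: measurable_past_noise.
Qed.

End filtration.

(** * The recursion for the exponential moments *)

(** One step of the recursion in real numbers: [F] stands for the gap, [Q] for |g_t|^2, [u] for 1/(t
    + 2), [S] and [S1] for (t + 2)^zeta and (t + 1)^zeta, [al] for the step size. *)
Lemma exponent_bound {R : realType} (a b B C F Q L N S S1 al g mu u : R) :
  0 <= a -> 0 <= L -> 0 <= N -> 0 <= mu -> 0 <= g -> 0 <= b <= B -> 0 <= F ->
  2 * mu * F <= Q -> Q <= 2 * L * F -> 0 <= S -> 0 <= u ->
  2 * L * N * B * a ^+ 2 + B * L * a ^+ 2 * C ^+ 2 / 2 <= a * mu * g ->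
  B * L * a ^+ 2 * C ^+ 2 / 2 * u <= 1 ->
  S * (1 - a * mu * g * u) <= S1 -> S * al ^+ 2 <= a ^+ 2 * u ->
  b * S * (F - a * g * u * Q + al ^+ 2 * (L * C ^+ 2 / 2)) +
    N * ((b * S * al) ^+ 2 * Q) <=
  b * (1 - B * L * a ^+ 2 * C ^+ 2 / 2 * u) * S1 * F +
    b * (a ^+ 2 * u * (L * C ^+ 2 / 2)).
Proof.
move=> a0 L0 N0 mu0 g0 /andP[b0 bB] F0 QF FQ S0 u0.
set wN := 2 * L * N * B * a ^+ 2; set wC := B * L * _ * _ / 2.
set lam := a * mu * g => wlam wC1 hS1 hS.
have B0 : 0 <= B := le_trans b0 bB.
have Q0 : 0 <= Q by apply: le_trans QF; rewrite !mulr_ge0.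
have lam0 : 0 <= lam by rewrite !mulr_ge0.
have a2 := sqr_ge0 a; have C20 := sqr_ge0 C; have al2 := sqr_ge0 al.
have wC0 : 0 <= wC by rewrite divr_ge0// mulr_ge0// mulr_ge0// mulr_ge0.
have T1 : b * S * a * g * u * (2 * mu * F) <= b * S * a * g * u * Q.
  by rewrite ler_wpM2l// !mulr_ge0.
have T2 : b * (L * C ^+ 2 / 2) * (S * al ^+ 2) <= b * (L * C ^+ 2 / 2) * (a ^+ 2 * u).
  by rewrite ler_wpM2l// mulr_ge0// divr_ge0// mulr_ge0.
(* The noise term is quadratic in [b]; b <= B and Q <= 2 L F turn it into a fraction of the linear
   term in [F]. *)
have T3 : N * ((b * S * al) ^+ 2 * Q) <= b * S * F * u * wN.
  have -> : N * ((b * S * al) ^+ 2 * Q) = N * b * S * (Q * (b * (S * al ^+ 2))).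
    by ring.
  have -> : b * S * F * u * wN = N * b * S * (2 * L * F * (B * (a ^+ 2 * u))).
    by rewrite /wN; ring.
  rewrite ler_wpM2l ?mulr_ge0//; apply: ler_pM => //.
    by rewrite mulr_ge0// mulr_ge0.
  by apply: ler_pM => //; rewrite mulr_ge0.
(* To first order in [u] this is wN + wC <= lam; the second-order term wC lam u^2 has the right
   sign. *)
have T4 : b * F * (S * (1 - (2 * lam - wN) * u)) <= b * F * ((1 - wC * u) * S1).
  rewrite ler_wpM2l ?mulr_ge0//.
  apply: (@le_trans _ _ ((1 - wC * u) * (S * (1 - lam * u)))); last first.
    by rewrite ler_wpM2l// subr_ge0.
  rewrite -subr_ge0.
  have -> : (1 - wC * u) * (S * (1 - lam * u)) - S * (1 - (2 * lam - wN) * u) =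
    S * (u * (lam - (wN + wC)) + wC * lam * (u * u)) by ring.
  apply: mulr_ge0 => //; apply: addr_ge0; apply: mulr_ge0; rewrite ?subr_ge0//.
    exact: mulr_ge0.
  exact: mulr_ge0.
rewrite /lam in T4; lra.
Qed.

(** * Deterministic growth of the iterates and gradients *)

Section iterates.
Context {R : realType} {d : nat} {disp : measure_display}.
Context {T : measurableType disp} {P : probability T R}.
Variables (f : 'rV[R]_d -> R) (L mu : R) (xstar : 'rV[R]_d).
Variables (Psi : 'rV[R]_d -> 'rV[R]_d) (C : R).
Variables (z : nat -> {RV P >-> 'rV[R]_d}) (p : 'rV[R]_d -> R).
Variables (x0 : 'rV[R]_d) (a delta N gamma : R).
Hypotheses (L0 : 0 < L) (fL : lipschitz_grad L f).
Hypotheses (mu0 : 0 < mu) (fmu : strongly_convex mu f).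
Hypothesis xstar_min : forall x, f xstar <= f x.
Hypothesis PsiC : forall x, normv (Psi x) <= C.
Hypotheses (delta01 : 2^-1 < delta < 1) (a0 : 0 < a).

Let alpha := step_size a delta.
Let x_ t w := sgd z f Psi alpha x0 t w.
Let g_ t w := grad f (x_ t w).

Lemma Psi_bound_ge0 : 0 <= C.
Proof. exact: le_trans (normv_ge0 _) (PsiC 0). Qed.

Lemma step_size_ge0 t : 0 <= alpha t.
Proof. by rewrite divr_ge0 ?powR_ge0// ltW. Qed.

(** Each step has length at most C alpha_t, and [powR_succ_ge] telescopes these lengths. *)
Lemma sgd_dist_le t w :
  normv (x_ t w - x0) <= C * (2 * a / (1 - delta)) * t.+2%:R `^ (1 - delta).
Proof.
have d0 : 0 < 1 - delta by move: delta01; lra.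
have K0 : 0 <= C * (2 * a / (1 - delta)).
  by rewrite mulr_ge0 ?Psi_bound_ge0// divr_ge0 ?mulr_ge0 ?(ltW a0)// ltW.
elim: t => [|t IH]; first by rewrite /x_ /= subrr normv0 mulr_ge0 ?powR_ge0.
rewrite /x_ /= addrAC; apply: le_trans (normvD _ _) _.
rewrite normvN normvZ ger0_norm ?step_size_ge0//.
have hC := ler_wpM2l (step_size_ge0 t) (PsiC (g_ t w + z t w)).
apply: le_trans (lerD IH hC) _.
have s1 : 1 <= t.+2%:R :> R by rewrite ler1n.
have := @powR_succ_ge R delta t.+2%:R ltac:(move: delta01; lra) s1.
move=> /(ler_wpM2l K0); rewrite natr1; apply: le_trans.
rewrite /alpha /step_size powRN le_eqVlt; apply/orP; left; apply/eqP.
by field; rewrite gt_eqF// gt_eqF// powR_gt0.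
Qed.

Lemma grad_sgd_le : exists2 G : R, 1 <= G & forall t w,
  normv (g_ t w) <= G * t.+2%:R `^ (1 - delta).
Proof.
have d0 : 0 < 1 - delta by move: delta01; lra.
have K0 : 0 <= C * (2 * a / (1 - delta)).
  by rewrite mulr_ge0 ?Psi_bound_ge0// divr_ge0 ?mulr_ge0 ?(ltW a0)// ltW.
exists (1 + normv (grad f x0) + L * (C * (2 * a / (1 - delta)))).
  by rewrite -addrA lerDl addr_ge0 ?normv_ge0// mulr_ge0// ltW.
move=> t w; have -> : g_ t w = (g_ t w - grad f x0) + grad f x0 by rewrite subrK.
apply: le_trans (normvD _ _) _.
have s1 : 1 <= t.+2%:R `^ (1 - delta) :> R.
  by have := ler_powR (ltac:(rewrite ler1n//) : 1 <= t.+2%:R :> R) (ltW d0);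
    rewrite powRr0.
have h1 := le_trans (fL (x_ t w) x0) (ler_wpM2l (ltW L0) (sgd_dist_le t w)).
have h2 : 0 <= (1 + normv (grad f x0)) * (t.+2%:R `^ (1 - delta) - 1).
  by rewrite mulr_ge0 ?subr_ge0// addr_ge0 ?normv_ge0.
have h3 : normv (g_ t w - grad f x0) <=
   L * (C * (2 * a / (1 - delta)) * t.+2%:R `^ (1 - delta)) by [].
lra.
Qed.

(* The gradients grow at most like (t + 2)^(1 - delta), whence the power of
   t + 2 in the rate. Shrinking [g] is harmless, and [a * mu * g <= 1] keeps
   the contraction factors of the recursion nonnegative. *)
Lemma growth_rate c : 0 < c ->
  (forall x, c * Num.min (normv x) (normv x ^+ 2) <= dotv (Phi Psi p x) x) ->
  exists g : R, [/\ 0 < g, a * mu * g <= 1 & forall t w,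
    g * t.+2%:R `^ (delta - 1) * normv (g_ t w) ^+ 2 <=
    dotv (Phi Psi p (g_ t w)) (g_ t w)].
Proof.
move=> c0 hc; have [G G1 hG] := grad_sgd_le.
have G0 : 0 < G by apply: lt_le_trans G1.
have am0 : 0 < a * mu by rewrite mulr_gt0.
pose g := Num.min (c / G) (a * mu)^-1.
have g0 : 0 < g by rewrite lt_min divr_gt0//= invr_gt0.
exists g; split => //.
  by rewrite mulrC -ler_pdivlMr// mul1r ge_min lexx orbT.
move=> t w; apply: le_trans (hc _); set n := normv _.
have n0 : 0 <= n := normv_ge0 _.
set s := t.+2%:R `^ (delta - 1).
have s0 : 0 <= s by exact: powR_ge0.
have s1 : s <= 1.
  have d1 : delta - 1 <= 0 by move: delta01; lra.
  by have := ler_powR (ltac:(rewrite ler1n//) : 1 <= t.+2%:R :> R) d1;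
    rewrite powRr0.
(* The exponents delta - 1 and 1 - delta cancel, so g s n^2 <= c n even where only linear growth is
   available. *)
have sn : s * n <= G.
  apply: le_trans (ler_wpM2l s0 (hG t w)) _.
  rewrite mulrCA /s -powRD; last by rewrite pnatr_eq0 implybT.
  by rewrite addrA subrK subrr powRr0 mulr1.
have gG : g * G <= c by rewrite -ler_pdivlMr// ge_min lexx.
have gc : g <= c.
  by apply: le_trans gG; rewrite ler_peMr// ltW.
rewrite minr_pMr ?(ltW c0)// le_min; apply/andP; split.
  have -> : g * s * n ^+ 2 = g * (s * n) * n by ring.
  apply: ler_wpM2r => //; apply: le_trans gG.
  by rewrite ler_wpM2l// ltW.
apply: ler_wpM2r; first exact: sqr_ge0.
by apply: le_trans gc; rewrite ler_piMr// ltW.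
Qed.

Lemma measurable_grad : measurable_fun setT (grad f).
Proof.
apply: measurable_fun_rVP => i.
apply: measurable_fun_rV_locally_lipschitz => x; exists L => y _.
apply: le_trans (fL y x).
by have := normv_coord_le (grad f y - grad f x) i; rewrite !mxE.
Qed.

(** Convexity from below and the descent inequality from above make [f] locally Lipschitz. *)
Lemma measurable_objective : measurable_fun setT f.
Proof.
apply: measurable_fun_rV_locally_lipschitz => x.
exists (normv (grad f x) + L / 2) => y yx.
have h1 := strongly_convex_ge mu0 fmu x y.
have := descent L0 fL mu0 fmu x (y - x); rewrite addrC subrK => h2.
have h3 := cauchy_schwarz (grad f x) (y - x).
move: h3; rewrite ler_norml => /andP[h3 h4].
have n0 := normv_ge0 (y - x).
have h5 : dotv (y - x) (y - x) <= normv (y - x).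
  by rewrite -sqr_normv expr2 ler_piMl.
have h6 := ler_wpM2l (ltW L0) h5; have h7 := mulr_ge0 (ltW L0) n0.
rewrite ler_norml; apply/andP; split; lra.
Qed.

End iterates.

(** * Exponential moments and tails of the gap *)

Section exponential_moment.
Context {R : realType} {d : nat} {disp : measure_display}.
Context {T : measurableType disp} {P : probability T R}.
Variables (f : 'rV[R]_d -> R) (L mu : R) (xstar : 'rV[R]_d).
Variables (Psi : 'rV[R]_d -> 'rV[R]_d) (C : R).
Variables (z : nat -> {RV P >-> 'rV[R]_d}) (p : 'rV[R]_d -> R).
Variables (x0 : 'rV[R]_d) (a delta N gamma B : R).
Hypotheses (L0 : 0 < L) (fL : lipschitz_grad L f).
Hypotheses (mu0 : 0 < mu) (fmu : strongly_convex mu f).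
Hypothesis xstar_min : forall x, f xstar <= f x.
Hypotheses (mPsi : measurable_fun setT Psi) (mp : measurable_fun setT p).
Hypothesis PsiC : forall x, normv (Psi x) <= C.
Hypotheses (delta01 : 2^-1 < delta < 1) (a0 : 0 < a) (N0 : 0 < N).

Let alpha := step_size a delta.
Let x_ t w := sgd z f Psi alpha x0 t w.
Let g_ t w := grad f (x_ t w).
Let F_ t w := f (x_ t w) - f xstar.
Let zeta := zeta_const a mu delta gamma.
Let D := B * L * a ^+ 2 * C ^+ 2 / 2.

Hypothesis subgaussian : subgaussian_effective_noise z p f Psi alpha x0 N.
Hypotheses (gamma0 : 0 < gamma) (lam1 : a * mu * gamma <= 1).
Hypothesis drift : forall t w,
  gamma * t.+2%:R `^ (delta - 1) * normv (g_ t w) ^+ 2 <=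
  dotv (Phi Psi p (g_ t w)) (g_ t w).
Hypotheses (B0 : 0 < B) (BF0 : B * (f x0 - f xstar) <= 1).
Hypothesis Blam : B * (a * L * (2 * N + C ^+ 2 / 2)) <= mu * gamma.

Lemma zeta_gt0 : 0 < zeta.
Proof.
rewrite lt_min; apply/andP; split; first by move: delta01; lra.
by rewrite divr_gt0// !mulr_gt0.
Qed.

Let w_ t (b : R) w : 'rV[R]_d := (b * t.+2%:R `^ zeta * alpha t) *: g_ t w.

(** The exponential of the next rescaled gap is bounded by this factor, known at time t, times the
    exponential of the noise tested against [w_], also known at time t. *)
Let V_ t b w : R := expR (b * t.+2%:R `^ zeta *
  (F_ t w - a * gamma * t.+2%:R^-1 * dotv (g_ t w) (g_ t w) +
    alpha t ^+ 2 * (L * C ^+ 2 / 2))).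

(** Multiplied by [a], [Blam] reads D + 2 N B L a^2 <= a mu gamma, and the right-hand side is at
    most 1. *)
Lemma excess_rate_bounds t : 0 <= D * t.+2%:R^-1 <= 1.
Proof.
have D0 : 0 <= D.
  rewrite /D divr_ge0// mulr_ge0 ?sqr_ge0// mulr_ge0 ?sqr_ge0//.
  by rewrite mulr_ge0// ltW.
have D1 : D <= 1.
  have := ler_wpM2l (ltW a0) Blam.
  have : 0 <= N * B * L * (a * a) by rewrite !mulr_ge0// ltW.
  by rewrite /D; move: lam1; lra.
rewrite mulr_ge0//= mulr_ile1// invf_le1// ler1n//.
Qed.

Lemma F_ge0 t w : 0 <= F_ t w.
Proof. by rewrite subr_ge0. Qed.

(** This is the demand zeta <= 2 delta - 1. *)
Lemma step_sqr_le t : t.+2%:R `^ zeta * alpha t ^+ 2 <= a ^+ 2 * t.+2%:R^-1.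
Proof.
have s0 : 0 < t.+2%:R :> R by [].
have s1 : 1 <= t.+2%:R :> R by rewrite ler1n.
rewrite /alpha /step_size expr_div_n mulrCA ler_wpM2l ?sqr_ge0//.
rewrite ler_pdivrMr ?exprn_gt0 ?powR_gt0//.
have -> : t.+2%:R^-1 * (t.+2%:R `^ delta) ^+ 2 = t.+2%:R `^ (2 * delta - 1) :> R.
  rewrite -(powR_inv1 (ltW s0)) -powR_mulrn ?powR_ge0// -powRrM -powRD.
    by congr powR; ring.
  by rewrite (gt_eqF s0) implybT.
by apply: ler_powR => //; rewrite ge_min lexx.
Qed.

(** This is the demand zeta <= a mu gamma / 2, the 1/2 offsetting the factor 2 of [powR_1B_ge]. *)
Lemma shifted_powR_ge t :
  t.+2%:R `^ zeta * (1 - a * mu * gamma * t.+2%:R^-1) <= t.+1%:R `^ zeta.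
Proof.
have s0 : 0 < t.+2%:R :> R by [].
have u2 : 0 <= (t.+2%:R^-1 : R) <= 2^-1.
  by rewrite invr_ge0 ler0n lef_pV2 ?posrE// ler_nat.
have u1 : 0 <= 1 - t.+2%:R^-1 :> R.
  by move: u2; set u := t.+2%:R^-1; lra.
have -> : t.+1%:R = t.+2%:R * (1 - t.+2%:R^-1) :> R.
  by rewrite mulrBr mulr1 divff ?gt_eqF// -(@natr1 R t.+1) addrK.
rewrite powRM//; apply: ler_wpM2l; first exact: powR_ge0.
apply: le_trans (powR_1B_ge (ltW zeta_gt0) u2).
have zl : 2 * zeta <= a * mu * gamma.
  suff : zeta <= a * mu * gamma / 2 by lra.
  by rewrite ge_min lexx orbT.
by rewrite lerD2l lerN2 ler_wpM2r//; case/andP: u2.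
Qed.

Lemma step_gap_le t b w : 0 <= b ->
  expR (b * t.+2%:R `^ zeta * F_ t.+1 w) <=
  V_ t b w * expR (dotv (w_ t b w) (effective_noise z p f Psi alpha x0 t w)).
Proof.
move=> b0; rewrite /V_ /w_ -expRD ler_expR; set u := t.+2%:R^-1.
set psi := Psi (g_ t w + z t w).
set S := t.+2%:R `^ zeta; set al := alpha t.
have S0 : 0 <= S by exact: powR_ge0.
have al0 : 0 <= al by exact: step_size_ge0.
have -> : effective_noise z p f Psi alpha x0 t w = Phi Psi p (g_ t w) - psi by [].
rewrite dotvZl dotvDr dotvNr.
have hd : F_ t.+1 w <= F_ t w - al * dotv (g_ t w) psi +
    al ^+ 2 * (L * C ^+ 2 / 2).
  have := descent L0 fL mu0 fmu (x_ t w) (- (al *: psi)).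
  rewrite dotvNr dotvZr dotvNl dotvNr opprK dotvZl dotvZr -sqr_normv => h.
  have psi2 : normv psi ^+ 2 <= C ^+ 2.
    by rewrite ler_sqr ?nnegrE ?normv_ge0 ?(Psi_bound_ge0 PsiC) ?PsiC.
  have h2 : al ^+ 2 * (L / 2) * normv psi ^+ 2 <= al ^+ 2 * (L / 2) * C ^+ 2.
    by rewrite ler_wpM2l// mulr_ge0 ?sqr_ge0// divr_ge0// ltW.
  have -> : F_ t.+1 w = f (x_ t w + - (al *: psi)) - f xstar by [].
  rewrite /F_; lra.
(* The step size times (t + 2)^(delta - 1) is a/(t + 2). *)
have hdr : a * gamma * u * dotv (g_ t w) (g_ t w) <=
    al * dotv (g_ t w) (Phi Psi p (g_ t w)).
  rewrite (dotvC (g_ t w) (Phi _ _ _)); apply: le_trans (ler_wpM2l al0 (drift t w)).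
  rewrite sqr_normv le_eqVlt; apply/orP; left; apply/eqP.
  have s0 : 0 < t.+2%:R :> R by [].
  rewrite powRD ?(gt_eqF s0) ?implybT// powR_inv1// -/u /al /alpha /step_size.
  by field; rewrite gt_eqF// gt_eqF// powR_gt0.
have h1 := ler_wpM2l (mulr_ge0 b0 S0) hd.
have h2 := ler_wpM2l (mulr_ge0 b0 S0) hdr.
lra.
Qed.

(* The left-hand side bounds the conditional expectation of the exponential of
   the next rescaled gap; the rate [b] drops by the factor [1 - D / (t + 2)],
   which pays for the constant factor on the right. *)
Lemma conditional_exponent_le t b w : 0 <= b <= B ->
  V_ t b w * expR (N * normv (w_ t b w) ^+ 2) <=
  expR (b * (a ^+ 2 * t.+2%:R^-1 * (L * C ^+ 2 / 2))) *
  expR (b * (1 - D * t.+2%:R^-1) * t.+1%:R `^ zeta * F_ t w).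
Proof.
move=> bB; rewrite /V_ -!expRD ler_expR sqr_normv.
have -> : dotv (w_ t b w) (w_ t b w) =
    (b * t.+2%:R `^ zeta * alpha t) ^+ 2 * dotv (g_ t w) (g_ t w).
  by rewrite /w_ dotvZl dotvZr mulrA expr2.
rewrite [leRHS]addrC.
apply: (@exponent_bound _ a b B C (F_ t w) _ L N _ _ _ gamma mu);
  rewrite ?(ltW a0) ?(ltW L0) ?(ltW N0) ?(ltW mu0) ?(ltW gamma0)//.
- exact: F_ge0.
- exact: (sqr_grad_ge mu0 fmu).
- exact: (sqr_grad_le L0 fL mu0 fmu xstar_min).
- have := ler_wpM2l (ltW a0) Blam; lra.
- by case/andP: (excess_rate_bounds t).
- exact: shifted_powR_ge.
- exact: step_sqr_le.
Qed.

Let mgrad := measurable_grad fL.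
Let mobj := measurable_objective L0 fL mu0 fmu.

Lemma measurable_past_F t : measurable_fun setT (F_ t : past z t -> R).
Proof.
apply: measurable_funB => //.
apply: (measurableT_comp mobj); exact: measurable_sgd.
Qed.

Lemma measurable_F t : measurable_fun setT (F_ t).
Proof. exact: (measurable_past_ambient (@measurable_past_F t)). Qed.

Lemma measurable_past_g t : measurable_fun setT (g_ t : past z t -> 'rV[R]_d).
Proof. by apply: (measurableT_comp mgrad); exact: measurable_sgd. Qed.

(** All rates are needed at once: the step at rate [b] calls the hypothesis at the smaller rate b (1
    - D/(t + 2)). *)
Lemma exponential_moment_le t b : 0 <= b <= B ->
  (\int[P]_w (expR (b * t.+1%:R `^ zeta * F_ t w))%:E <= (expR (b / B))%:E)%E.
Proof.
elim: t b => [|t IH] b bB; have /andP[b0 b1] := bB.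
  rewrite (_ : (fun w => _) = cst (expR (b * (f x0 - f xstar)))%:E); last first.
    by apply/funext => w /=; rewrite powR1 mulr1.
  rewrite integral_cst//= probability_setT mule1 lee_fin ler_expR.
  by rewrite ler_wpM2l// -[B^-1]mul1r ler_pdivlMr// mulrC.
have mg := @measurable_past_g t.
have mw : measurable_fun setT (w_ t b : past z t -> 'rV[R]_d).
  exact: measurable_rVZ.
have mV : measurable_fun setT (V_ t b : past z t -> R).
  apply: measurableT_comp => //; apply: measurable_funM => //.
  apply: measurable_funD => //; apply: measurable_funB.
    exact: measurable_past_F.
  by apply: measurable_funM => //; exact: measurable_dotv.
have mUp : measurable_fun setT
    ((fun w => expR (N * normv (w_ t b w) ^+ 2)) : past z t -> R).
  apply: measurableT_comp => //; apply: measurable_funM => //.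
  by apply: measurable_funX; exact: (measurableT_comp measurable_normv mw).
have mU := measurable_past_ambient mUp.
have [W [WE WU]] := subgaussian (measurable_past_filtration mw).
pose Y w := expR (dotv (w_ t b w) (effective_noise z p f Psi alpha x0 t w)).
have mY : measurable_fun setT Y.
  apply: measurableT_comp => //; apply: measurable_dotv.
    exact: (measurable_past_ambient mw).
  have mgT := measurable_past_ambient mg.
  apply: measurable_rVB.
    exact: (measurableT_comp (measurable_Phi mPsi mp) mgT).
  by apply: (measurableT_comp mPsi); apply: measurable_rVD.
(* At a fixed time the gradient is bounded by a deterministic constant. *)
have Ufin : (\int[P]_w (expR (N * normv (w_ t b w) ^+ 2))%:E < +oo)%E.
  have [G G1 hG] := grad_sgd_le z x0 L0 fL PsiC delta01 a0.
  pose M := b * t.+2%:R `^ zeta * alpha t * (G * t.+2%:R `^ (1 - delta)).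
  apply: (@le_lt_trans _ _ (\int[P]_w (cst (expR (N * M ^+ 2))%:E w))%E).
    apply: ge0_le_integral => //.
    - exact/measurable_EFinP.
    - move=> w _; rewrite lee_fin ler_expR ler_wpM2l ?(ltW N0)//.
      have k0 : 0 <= b * t.+2%:R `^ zeta * alpha t.
        by rewrite mulr_ge0 ?step_size_ge0// mulr_ge0 ?powR_ge0.
      have wM : normv (w_ t b w) <= M.
        by rewrite normvZ ger0_norm// ler_wpM2l// hG.
      by rewrite ler_sqr ?nnegrE ?normv_ge0// (le_trans (normv_ge0 _) wM).
  by rewrite integral_cst//= probability_setT mule1 ltry.
have step := @cond_exp_weight_le _ _ _ P _ (EFin \o Y) W _ (V_ t b)
  (@filtration_measurable _ _ _ _ _ z t) _ _ WE mU (fun=> expR_ge0 _) Ufin WU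
  (measurable_past_filtration mV) (fun=> expR_ge0 _).
pose b' := b * (1 - D * t.+2%:R^-1).
pose K := b * (a ^+ 2 * t.+2%:R^-1 * (L * C ^+ 2 / 2)).
have mF1 : measurable_fun setT (fun w => expR (b * t.+2%:R `^ zeta * F_ t.+1 w)).
  apply: measurableT_comp => //; apply: measurable_funM => //.
  exact: measurable_F.
have mF0 : measurable_fun setT (fun w => expR (b' * t.+1%:R `^ zeta * F_ t w)).
  apply: measurableT_comp => //; apply: measurable_funM => //.
  exact: measurable_F.
have mVT := measurable_past_ambient mV.
apply: (@le_trans _ _ (\int[P]_w ((V_ t b w)%:E * (EFin \o Y) w))%E).
  apply: ge0_le_integral => //.
  - exact/measurable_EFinP.
  - by apply/measurable_EFinP; exact: measurable_funM.
  by move=> w _; rewrite -EFinM lee_fin step_gap_le.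
apply: le_trans (step _ _) _.
- exact/measurable_EFinP.
- by move=> w; rewrite lee_fin expR_ge0.
apply: (@le_trans _ _ (\int[P]_w ((expR K)%:E * (expR (b' * t.+1%:R `^ zeta * F_ t w))%:E))%E).
  apply: ge0_le_integral => //.
  - by move=> w _; rewrite lee_fin mulr_ge0 ?expR_ge0.
  - by apply/measurable_EFinP; exact: measurable_funM.
  - by apply: measurable_funeM; exact/measurable_EFinP.
  by move=> w _; rewrite -EFinM lee_fin conditional_exponent_le.
have /andP[D0 D1] := excess_rate_bounds t.
have b'B : 0 <= b' <= B.
  rewrite mulr_ge0 ?subr_ge0//=; apply: le_trans b1.
  by rewrite ler_piMr// lerBlDr lerDl.
rewrite ge0_integralZl_EFin//; last exact/measurable_EFinP.
apply: (@le_trans _ _ ((expR K)%:E * (expR (b' / B))%:E)%E).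
  by apply: lee_wpmul2l; [rewrite lee_fin expR_ge0|exact: IH].
(* Exact balance: K = b D / (B (t + 2)) is what b'/B lost from b/B. This is why the bound exp(b / B)
   reproduces itself. *)
rewrite -EFinM -expRD lee_fin ler_expR le_eqVlt; apply/orP; left; apply/eqP.
rewrite /K /b' /D; set u := t.+2%:R^-1; clearbody u.
by field; rewrite gt_eqF.
Qed.

Lemma measurable_gap_tail t c :
  measurable [set w | (c < B * t.+1%:R `^ zeta * F_ t w)%R].
Proof.
have mY : measurable_fun setT (fun w => B * t.+1%:R `^ zeta * F_ t w).
  by apply: measurable_funM => //; exact: measurable_F.
have := mY measurableT `]c, +oo[%classic (measurable_itv _).
rewrite setTI; congr measurable; apply/seteqP; split => w /=;
by rewrite in_itv/= andbT.
Qed.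

(** At the largest rate the moment is at most exp(B / B) = e, the origin of the e in log(e /
    beta). *)
Lemma gap_tail_le t beta : 0 < beta < 1 ->
  (P [set w | (ln (expR 1 / beta) < B * t.+1%:R `^ zeta * F_ t w)%R] <= beta%:E)%E.
Proof.
move=> /andP[b0 b1].
have e0 : 0 < expR 1 / beta :> R by rewrite divr_gt0// expR_gt0.
set bad := [set w | _].
have mY : measurable_fun setT (fun w => B * t.+1%:R `^ zeta * F_ t w).
  by apply: measurable_funM => //; exact: measurable_F.
have mbad : measurable bad by exact: measurable_gap_tail.
have mE : measurable_fun setT (fun w => (expR (B * t.+1%:R `^ zeta * F_ t w))%:E).
  by apply/measurable_EFinP; exact: measurableT_comp.
have BB : 0 <= B <= B by rewrite ltW/=.
have h : ((expR 1 / beta)%:E * P bad <= (expR 1)%:E)%E.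
  have -> : (expR 1 : R) = expR (B / B) by rewrite divff// gt_eqF.
  apply: le_trans (exponential_moment_le t BB).
  rewrite divff ?gt_eqF// -integral_cst//.
  apply: (@le_trans _ _
      (\int[P]_(w in bad) (expR (B * t.+1%:R `^ zeta * F_ t w))%:E)%E).
    apply: ge0_le_integral => //.
    - by move=> w _; rewrite /= lee_fin ltW.
    - exact: measurable_funTS.
    move=> w /ltW; rewrite -ler_expR lnK ?posrE//.
  by apply: ge0_subset_integral.
move: h; rewrite -lee_pdivlMl// => /le_trans; apply.
by rewrite -EFinM lee_fin invfM invrK mulrAC mulVf ?mul1r ?gt_eqF// expR_gt0.
Qed.

Lemma dist_tail_ge t beta : 0 < beta < 1 ->
  ((1 - beta)%:E <=
    P [set w | (normv (x_ t w - xstar) ^+ 2 <=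
                2 * ln (expR 1 / beta) / (mu * B * t.+1%:R `^ zeta))%R])%E.
Proof.
move=> beta01; have := gap_tail_le t beta01; set bad := [set w | _] => Pbad.
set good := [set w | _].
have mbad : measurable bad by exact: measurable_gap_tail.
have mgood : measurable good.
  set r := _ / _ in good *.
  have mx : measurable_fun setT (fun w => normv (x_ t w - xstar) ^+ 2).
    apply: measurable_funX; apply: (measurableT_comp measurable_normv).
    apply: measurable_rVB => //.
    have mp_ : measurable_fun setT (x_ t : past z t -> 'rV[R]_d).
      exact: measurable_sgd.
    exact: (measurable_past_ambient mp_).
  have := mx measurableT `]-oo, r]%classic (measurable_itv _).
  by rewrite setTI; congr measurable; apply/seteqP; split => w /=;
    rewrite in_itv.
apply: (@le_trans _ _ (P (~` bad))).
  rewrite probability_setC// EFinB leeB//.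
apply: le_measure; rewrite ?inE//; first exact: measurableC.
move=> w /negP; rewrite -leNgt /good /= => h.
have S0 : 0 < t.+1%:R `^ zeta :> R by rewrite powR_gt0.
apply: le_trans (sqr_dist_le L0 fL mu0 fmu xstar_min _) _.
rewrite ler_pdivlMr; last by rewrite !mulr_gt0.
have -> : 2 / mu * (f (x_ t w) - f xstar) * (mu * B * t.+1%:R `^ zeta) =
   2 * (B * t.+1%:R `^ zeta * F_ t w) by rewrite /F_; field; rewrite gt_eqF.
by rewrite ler_wpM2l.
Qed.

End exponential_moment.

(** * The constant B, the growth of Phi and the conclusion *)

Lemma B_constP {R : realType} (gap a L mu N C gamma : R) :
  0 <= gap -> 0 < a -> 0 < L -> 0 < mu -> 0 < N -> 0 < gamma ->
  let B := B_const gap a L mu N C gamma in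
  [/\ 0 < B, B * gap <= 1 & B * (a * L * (2 * N + C ^+ 2 / 2)) <= mu * gamma].
Proof.
move=> gap0 a0 L0 mu0 N0 gamma0.
have den0 : 0 < a * L * (2 * N + C ^+ 2 / 2).
  by rewrite !mulr_gt0// ltr_pwDl ?mulr_gt0// divr_ge0// sqr_ge0.
rewrite /B_const; set k := _ / _.
have k0 : 0 < k by rewrite divr_gt0// mulr_gt0.
have kE : k * (a * L * (2 * N + C ^+ 2 / 2)) = mu * gamma.
  by rewrite divfK// gt_eqF.
have [gap_gt0|] := ltP 0 gap; last first.
  move=> gap_le0; have -> : gap = 0 by apply/eqP; rewrite eq_le gap_le0.
  (* Starting at the minimizer, 1/0 = +oo and the minimum is its second argument. *)
  rewrite inve0 min_r ?leey//=; split => //; last by rewrite kE.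
  by rewrite mulr0.
rewrite inver (gt_eqF gap_gt0) -EFin_min /=; split.
- by rewrite lt_min invr_gt0 gap_gt0.
- by rewrite -ler_pdivlMr// mul1r ge_min lexx.
- by rewrite -kE ler_pM2r// ge_min lexx orbT.
Qed.

Lemma admissible_growth {R : realType} {d : nat} {disp : measure_display}
    {T : measurableType disp} {P : probability T R}
    (Psi : 'rV[R]_d -> 'rV[R]_d) (C : R)
    (z : nat -> {RV P >-> 'rV[R]_d}) (p : 'rV[R]_d -> R) :
  admissible Psi C -> noise_assumption z p -> polyak_tsypkin Psi p ->
  exists2 c : R, 0 < c & forall x : 'rV[R]_d,
    c * Num.min (normv x) (normv x ^+ 2) <= dotv (Phi Psi p x) x.
Proof.
move=> [[N1 [C1 [cw _ _]]]|[N2 [C2 [jt aN2 _]]]] zp PT.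
  exact: componentwise_growth PT cw.
(* In dimension 1 every z is parallel to x and the cone of [joint_pair_ge] shrinks to z = 0, so
   another argument is required. *)
have [d1|d1] := ltnP 1 d; first exact: (joint_growth zp d1 jt aN2).
(* In dimension at most 1 a joint nonlinearity is component-wise. *)
apply: (componentwise_growth PT (N1 := fun u => N2 `|u| * u)) => x.
apply/rowP => i; rewrite jt !mxE; congr (N2 _ * _).
rewrite /normv /dotv (bigD1 i)//= big1 ?addr0 -?expr2 ?sqrtr_sqr// => j ji.
have := ltn_ord i; have := ltn_ord j; move: ji; rewrite -val_eqE /=; lia.
Qed.

Theorem theorem3 (R : realType) (d : nat) (disp : measure_display)
  (T : measurableType disp) (P : probability T R)
  (f : 'rV[R]_d -> R) (L mu : R) (xstar : 'rV[R]_d)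
  (Psi : 'rV[R]_d -> 'rV[R]_d) (C : R)
  (z : nat -> {RV P >-> 'rV[R]_d}) (p : 'rV[R]_d -> R)
  (x0 : 'rV[R]_d) (a delta N : R) :
  (forall x, differentiable f x) ->
  0 < L -> lipschitz_grad L f ->
  0 < mu -> strongly_convex mu f ->
  (forall y, (forall x, f y <= f x) <-> y = xstar) ->
  admissible Psi C ->
  (forall x, normv (Psi x) <= C) ->
  noise_assumption z p ->
  polyak_tsypkin Psi p ->
  2^-1 < delta < 1 ->
  0 < a ->
  let alpha := step_size a delta in
  0 < N -> subgaussian_effective_noise z p f Psi alpha x0 N ->
  let fstar := inf (range f) in
  exists2 gamma : R, 0 < gamma &
    {ae P, forall w, forall t : nat,
       let g := grad f (sgd z f Psi alpha x0 t w) in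
       dotv (Phi Psi p g) g >= gamma * t.+2%:R `^ (delta - 1) * normv g ^+ 2} /\
    (let zeta := zeta_const a mu delta gamma in
     let B := B_const (f x0 - fstar) a L mu N C gamma in
     forall (t : nat) (beta : R), 0 < beta < 1 ->
       ((1 - beta)%:E <=
        P [set w | (normv (sgd z f Psi alpha x0 t.+1 w - xstar) ^+ 2 <=
                    2 * ln (expR 1 / beta) /
                    (mu * B * t.+2%:R `^ zeta))%R])%E).
Proof.
move=> _ L0 fL mu0 fmu xstarP aPsi PsiC zp PT delta01 a0 alpha N0 sub fstar.
have xstar_min : forall x, f xstar <= f x by exact/(xstarP xstar).
have fstarE : fstar = f xstar.
  apply/eqP; rewrite eq_le; apply/andP; split.
    by apply: ge_inf; [exists (f xstar) => _ [x _ <-]|exists xstar].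
  by apply: lb_le_inf; [exists (f xstar), xstar|move=> _ [x _ <-]].
have mPsi := admissible_measurable aPsi.
have mp := noise_density_measurable zp.
have [c c0 growth] := admissible_growth aPsi zp PT.
have [gamma [gamma0 lam1 drift]] :=
  growth_rate z x0 L0 fL mu0 PsiC delta01 a0 c0 growth.
exists gamma => //; split; first by apply: aeW => w t; exact: drift.
move=> zeta B t beta beta01.
have gap0 : 0 <= f x0 - fstar by rewrite subr_ge0 fstarE.
have [B0 BF0 Blam] := B_constP C gap0 a0 L0 mu0 N0 gamma0.
have BF0' : B * (f x0 - f xstar) <= 1 by rewrite -fstarE.
(* The tail bound at time s carries the weight (s + 1)^zeta; s = t + 1 gives (t + 2)^zeta. *)
exact: (dist_tail_ge L0 fL mu0 fmu xstar_min mPsi mp PsiC delta01 a0 N0 sub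
  gamma0 lam1 drift B0 BF0' Blam t.+1 beta01).
Qed.
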